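(* Let $F\colon \mathbf{R}^2\to\mathbf{R}$ be a function such that for every $y\in(0,\pi)$ the function $x\mapsto F(\sqrt{x},y)$ is convex and (strictly) decreasing on $(0,y^2]$, and suppose that $$f[c] := \iint F\left(|c(s)-c(t)|,\, d(s,t)\right)\,ds\,dt$$ is a renormalization energy, i.e. this integral converges for every embedded $C^{1,1}$ closed curve $c$ parametrized by arclength. Then among all closed unit-speed curves $c$ of length $2\pi$ in $\mathbf{R}^n$ ($n\ge 2$), $f$ is uniquely minimized by the round unit circle: if $c_0$ denotes the unit-speed round unit circle, then $f[c]\ge f[c_0]$ for every closed unit-speed curve $c$ of length $2\pi$, with equality if and only if $c$ is a round circle of radius $1$.
   Context: A closed unit-speed curve of length $2\pi$ in $\mathbf{R}^n$ is an absolutely continuous map $c\colon S^1=\mathbf{R}/2\pi\mathbf{Z}\to\mathbf{R}^n$ with $|c'(t)|=1$ for almost every $t$. Here $|c(s)-c(t)|$ is the distance in $\mathbf{R}^n$ between $c(s)$ and $c(t)$, and $d(s,t)$ is the shortest distance between $c(s)$ and $c(t)$ along the curve, i.e. $d(s,t)=\min_{k\in\mathbf{Z}}|s-t+2\pi k|$. The double integral is over $S^1\times S^1$; the value $+\infty$ is allowed for curves for which the integral diverges. *)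

(* Defs.v *)
From HB Require Import structures.
From mathcomp Require Import all_boot all_order all_algebra.
From mathcomp Require Import all_classical all_reals all_analysis.
Set Implicit Arguments.
Unset Strict Implicit.
Unset Printing Implicit Defensive.
Import Order.TTheory GRing.Theory Num.Theory.
Import numFieldNormedType.Exports.
Local Open Scope classical_set_scope.
Local Open Scope ring_scope.

(* Maps on S^1 = R / 2 pi Z are represented by (pi *+ 2)-periodic maps on R. *)

Definition dotmul (R : realType) (n : nat) (u v : 'rV[R]_n) : R :=
  \sum_(i < n) u ord0 i * v ord0 i.

(* The library norm `|u| on 'rV[R]_n is the sup norm. It induces the same
   topology, derivatives and Lipschitz maps as the Euclidean norm, but lengths
   and distances have to be measured with the latter. *)
Definition enorm (R : realType) (n : nat) (u : 'rV[R]_n) : R :=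
  Num.sqrt (dotmul u u).

Definition abs_continuous (R : realType) (n : nat) (a b : R)
    (c : R -> 'rV[R]_n) : Prop :=
  forall e : R, 0 < e -> exists2 d : R, 0 < d &
    forall (m : nat) (x y : 'I_m -> R),
      (forall i, a <= x i /\ x i <= y i /\ y i <= b) ->
      trivIset [set: 'I_m] (fun i => `]x i, y i[%classic) ->
      \sum_(i < m) (y i - x i) < d ->
      \sum_(i < m) enorm (c (y i) - c (x i)) < e.

Definition closed_unit_speed (R : realType) (n : nat)
    (c : R -> 'rV[R]_n) : Prop :=
  [/\ periodic c (pi *+ 2),
      abs_continuous 0 (pi *+ 2) c &
      {ae @lebesgue_measure R,
        forall t, derivable c t 1 /\ enorm (derive1 c t) = 1}].

(* On a closed curve, injectivity on S^1 together with nonvanishing velocity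
   amounts to being an embedding. *)
Definition embedded_C11 (R : realType) (n : nat)
    (c : R -> 'rV[R]_n) : Prop :=
  [/\ periodic c (pi *+ 2),
      forall s t, c s = c t -> exists k : int, s - t = (pi *+ 2) *~ k,
      forall t, derivable c t 1 /\ enorm (derive1 c t) = 1 &
      lipschitz (derive1 c)].

Definition circle_dist (R : realType) (s t : R) : R :=
  inf [set `|s - t + (pi *+ 2) *~ k| | k in [set: int]].

(* [0, 2 pi[ x [0, 2 pi[ is a fundamental domain for S^1 x S^1. *)
Definition torus (R : realType) : set (R * R) :=
  `[0, pi *+ 2[%classic `*` `[0, pi *+ 2[%classic.

Notation leb2 R := (@lebesgue_measure R \x @lebesgue_measure R)%E.

Definition energy_density (R : realType) (n : nat) (F : R -> R -> R)
    (c : R -> 'rV[R]_n) (z : R * R) : \bar R :=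
  (F (enorm (c z.1 - c z.2)) (circle_dist z.1 z.2))%:E.

(* lebesgue_measure lives on the Borel sigma-algebra. The library integral of a
   nonnegative function is the supremum of the integrals of the simple functions
   below it, so on functions that are measurable for the completed
   sigma-algebra it is the usual Lebesgue integral. *)
Definition energy (R : realType) (n : nat) (F : R -> R -> R)
    (c : R -> 'rV[R]_n) : \bar R :=
  (\int[leb2 R]_(z in @torus R) energy_density F c z)%E.

(* Integrability for the completed measure. The library predicate [integrable]
   requires Borel measurability; nothing of the kind is assumed about F. *)
Definition lebesgue_integrable (R : realType) (D : set (R * R))
    (f : R * R -> \bar R) : Prop :=
  exists2 g : R * R -> \bar R, (leb2 R).-integrable D g &
    {ae leb2 R, forall z, D z -> f z = g z}.

Definition renormalization_energy (R : realType) (n : nat)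
    (F : R -> R -> R) : Prop :=
  forall c : R -> 'rV[R]_n, embedded_C11 c ->
    lebesgue_integrable (@torus R) (energy_density F c).

Definition unit_circle (R : realType) (n : nat) (t : R) : 'rV[R]_n :=
  \row_(i < n) (if val i == 0%N then cos t
                else if val i == 1%N then sin t else 0).

(* The base point and the orientation of the unit-speed parametrization are
   absorbed by the choice of the orthonormal pair (u, v). *)
Definition round_circle1 (R : realType) (n : nat)
    (c : R -> 'rV[R]_n) : Prop :=
  exists p u v : 'rV[R]_n,
    [/\ enorm u = 1, enorm v = 1, dotmul u v = 0 &
        forall t, c t = p + cos t *: u + sin t *: v].

(* Main.v *)
(* Fix the offset y along the curve. The convex decreasing function x |-> F (sqrt x, y) lies
   above a supporting line of slope - w(y) < 0 at a0(y) = 2 - 2 cos y, the squared chord of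
   the unit circle. So it suffices that the mean squared chord of offset y of a unit-speed
   curve is at most a0(y), with equality for all y only for round circles.

   Let s(y) = sin (y / 2). The integral over t of
     |s(y-e) (c(t+y+e) - c(t)) - s(y+e) (c(t+y) - c(t+e))|^2 >= 0,
   which vanishes for the unit circle, expands into mean squared chords of offsets y, e, y+e
   and y-e. Letting e tend to 0, it excludes a negative minimum over y of
   (2 pi a0(y) - total squared chord) / s(y)^2.

   F is not assumed measurable, so w has to be chosen measurably and such that
   w(y) (y^2 - a0(y)) is integrable. It is read off from the integrability of the energy
   density of one more embedded curve, a stadium, whose squared chords of offset y lie on
   both sides of a0(y): w(y) is the infimum of the slopes of the chords of x |-> F (sqrt x, y)
   between a0(y) and the smaller squared chords of the stadium that start at points of a
   countable dense set. *)
Require Import Defs.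
From HB Require Import structures.
From mathcomp Require Import all_boot all_order all_algebra.
From mathcomp Require Import all_classical all_reals all_analysis.
From mathcomp Require Import measurable_realfun ring lra.
Import Order.TTheory GRing.Theory Num.Theory.
Import numFieldNormedType.Exports.
Local Open Scope classical_set_scope.
Local Open Scope ring_scope.

(** The energy may be infinite and [w] is controlled by a single integrability statement, so two
    possibly infinite integrals are never subtracted. The supporting line is evaluated at the
    largest possible squared chord, d^2 for points at distance d along the curve. This gives an
    integrable part p(d) - w(d) (d^2 - a0(d)), common to all curves, and leaves w(d) (d^2 -
    |chord|^2) >= 0, to which Tonelli's theorem applies.

    The circle yields only one value of x |-> F (sqrt x, y) for each y, hence no slope. Around the
    middle of a half circle of radius 1/2 the tangent of the stadium turns faster than that of the
    unit circle, around the middle of a side more slowly; by the intermediate value theorem its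
    squared chords of offset y accumulate at a0(y) from below, as the infimum of slopes demands.
    With both ends on one half circle the squared chord is sin(y)^2 = a0(y) - (1 - cos y)^2. This
    gap has order y^4, like y^2 - a0(y), so a chord slope there controls w (y^2 - a0) down to y = 0.
    The curvature of the stadium jumps, but its tangent is Lipschitz, so it is an admissible C^{1,1}
    test curve. *)

(** * Integrals of nonmeasurable functions and almost everywhere statements *)

Section integral_tools.
Set Implicit Arguments.
Unset Strict Implicit.
Context d (T : measurableType d) (R : realType).
Variable mu : {measure set T -> \bar R}.
Local Open Scope ereal_scope.
Import HBNNSimple.

(* No measurability is needed: the integral of a nonnegative function is the
   supremum of the simple integrals below it, and a simple function can be set
   to zero on a null set without changing its integral. *)
Lemma ae_le_integral_nonmeasurable (D : set T) (f g : T -> \bar R) :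
  {ae mu, forall x, D x -> f x <= g x} ->
  \int[mu]_(x in D) f x <= \int[mu]_(x in D) g x.
Proof.
suff ae_le_nn (h k : T -> \bar R) : (forall x, 0 <= h x) -> (forall x, 0 <= k x) ->
    {ae mu, forall x, D x -> h x <= k x} ->
    \int[mu]_(x in D) h x <= \int[mu]_(x in D) k x.
  move=> fg; rewrite (integralE mu D f) (integralE mu D g); apply: leeB.
    apply: ae_le_nn => //.
    apply: filterS fg => x fg Dx; rewrite !funeposE.
    by rewrite ge_max !le_max (fg Dx) lexx orbT.
  apply: ae_le_nn => //.
  apply: filterS fg => x fg Dx; rewrite !funenegE.
  by rewrite ge_max !le_max leeN2 (fg Dx) lexx orbT.
move=> h0 k0 [N [mN N0 hkN]].
rewrite !ge0_integralE//; apply: ge_ereal_sup => _ [u /= uh <-].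
have mNc : measurable (~` N) by exact: measurableC.
have -> : sintegral mu u = sintegral mu (proj_nnsfun u mNc).
  rewrite -!integralT_nnsfun.
  rewrite (@ge0_negligible_integral _ _ _ mu setT N)//; last 2 first.
    exact/measurable_EFinP.
    by move=> x _; rewrite lee_fin.
  rewrite setTD integral_mkcond; apply: eq_integral => x _ /=.
  by rewrite patchE /= mindicE; case: ifPn; rewrite ?mulr1 ?mulr0.
apply: ereal_sup_ubound; exists (proj_nnsfun u mNc) => //= x.
rewrite mindicE; case: (boolP (x \in ~` N)) => [|xN]; rewrite ?mulr0 ?mulr1//.
  move=> xN; rewrite patchE; have := uh x; rewrite patchE.
  case: ifPn => Dx; last by [].
  move=> /le_trans; apply.
  apply: contrapT => hk; move: xN; rewrite inE/=; apply; apply: hkN => /= hk'.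
  by apply: hk; apply: hk'; rewrite inE in Dx.
by rewrite patchE; case: ifPn => //.
Qed.

Lemma ae_eq_integral_nonmeasurable (D : set T) (f g : T -> \bar R) :
  {ae mu, forall x, D x -> f x = g x} ->
  \int[mu]_(x in D) f x = \int[mu]_(x in D) g x.
Proof.
move=> fg; apply/eqP; rewrite eq_le !ae_le_integral_nonmeasurable//;
  by apply: filterS fg => x fg Dx; rewrite fg.
Qed.

Lemma ae_imply (P Q : T -> Prop) : (forall x, P x -> Q x) ->
  {ae mu, forall x, P x} -> {ae mu, forall x, Q x}.
Proof.
by move=> PQ [N [mN N0 NP]]; exists N; split => // x /= nQ; apply: NP => /= /PQ.
Qed.

Lemma ae_imply2 (P1 P2 Q : T -> Prop) : (forall x, P1 x -> P2 x -> Q x) ->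
  {ae mu, forall x, P1 x} -> {ae mu, forall x, P2 x} -> {ae mu, forall x, Q x}.
Proof.
move=> PQ [N1 [mN1 N10 NP1]] [N2 [mN2 N20 NP2]].
exists (N1 `|` N2); split; first exact: measurableU.
  by rewrite measureU0.
move=> x /= nQ; have [P1x|nP1] := pselect (P1 x); last by left; exact: NP1.
have [P2x|nP2] := pselect (P2 x); last by right; exact: NP2.
by exfalso; apply: nQ; exact: PQ.
Qed.

(** Covers an infinite integral of [g], as happens for curves of infinite energy: the negative part
    of [f + g] is dominated by that of [f], while [g <= (f + g)^+ + |f|] makes the integral of the
    positive part infinite. *)
Lemma integralD_ge0 (D : set T) (f g : T -> \bar R) : measurable D ->
  mu.-integrable D f -> measurable_fun D g -> (forall x, D x -> 0 <= g x) ->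
  \int[mu]_(x in D) (f x + g x) = \int[mu]_(x in D) f x + \int[mu]_(x in D) g x.
Proof.
move=> mD intf mg g0.
have [intg|] := boolP (\int[mu]_(x in D) g x < +oo).
  apply: integralD => //; apply/integrableP; split => //.
  by under eq_integral => x /set_mem Dx do rewrite gee0_abs ?g0//.
rewrite -leNgt leye_eq => /eqP goo; rewrite goo.
have ffin : \int[mu]_(x in D) f x \is a fin_num by exact: integrable_fin_num.
rewrite addey; last by move: ffin; rewrite fin_numE => /andP[].
have mf := measurable_int _ intf.
have nfin : \int[mu]_(x in D) (fun x => f x + g x)^\- x < +oo.
  apply: (le_lt_trans _ (integral_funeneg_lt_pinfty mD intf)).
  apply: ge0_le_integral => //.
  - by apply: measurable_funeneg; apply: emeasurable_funD.
  - exact: measurable_funeneg.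
  - move=> x Dx; rewrite !funenegE ge_max !le_max (lexx 0) orbT andbT.
    by rewrite leeN2 leeDl ?g0.
rewrite integralE.
suff -> : \int[mu]_(x in D) (fun x => f x + g x)^\+ x = +oo.
  by move: nfin; case: (integral _ _ _).
have : \int[mu]_(x in D) g x <=
    \int[mu]_(x in D) ((fun x => f x + g x)^\+ x + `|f x|).
  apply: ae_le_integral_nonmeasurable.
  have := integrable_ae mD intf; apply: filterS => x fx Dx.
  rewrite funeposE /=; have := fx Dx; have := g0 x Dx.
  case: (f x) => // r; case: (g x) => [s||]// s0 _; rewrite -?EFinD.
  rewrite -EFin_max -EFinD !lee_fin.
  have : (r + s <= Order.max (r + s) 0)%R by rewrite le_max lexx.
  have := ler_norm (- r); rewrite normrN; lra.
rewrite goo leye_eq ge0_integralD//; last 2 first.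
- by apply: measurable_funepos; apply: emeasurable_funD.
- exact: measurableT_comp.
move: intf => /integrableP[_ fin].
have : 0 <= \int[mu]_(x in D) `|f x| by exact: integral_ge0.
move: fin; case: (\int[mu]_(x in D) `|f x|) => // r _ _.
by case: (integral _ _ _).
Qed.

Lemma integrable_EFinD (D : set T) (f g : T -> R) : measurable D ->
  mu.-integrable D (EFin \o f) -> mu.-integrable D (EFin \o g) ->
  mu.-integrable D (EFin \o (fun x => f x + g x)%R).
Proof. by move=> mD fi gi; apply: (eq_integrable mD _ _ _ (integrableD mD fi gi)). Qed.

Lemma integrable_EFinZ (D : set T) (k : R) (f : T -> R) : measurable D ->
  mu.-integrable D (EFin \o f) -> mu.-integrable D (EFin \o (fun x => k * f x)%R).
Proof. by move=> mD fi; apply: (eq_integrable mD _ _ _ (integrableZl mD k fi)). Qed.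

End integral_tools.

(** * Representatives modulo the period *)

Section period.
Set Implicit Arguments.
Unset Strict Implicit.
Context (R : realType).
Local Notation T := (@pi R *+ 2).

Lemma periodicMz (V : Type) (f : R -> V) (k : int) : (forall x, f (x + T) = f x) ->
  forall x, f (x + T *~ k) = f x.
Proof.
move=> fT; have fn (m : nat) x : f (x + T *+ m) = f x.
  by elim: m x => [|m IH] x; rewrite ?mulr0n ?addr0// mulrSr addrA fT IH.
case: k => m x; first exact: fn.
by rewrite NegzE mulrNz -(fn m.+1) subrK.
Qed.

Lemma period_representative (s : R) :
  exists k : int, (0 <= s + T *~ k < T).
Proof.
have T0 : (0 < T) by rewrite pmulrn_lgt0// pi_gt0.
exists (- Num.floor (s / T)); have := floor_itv (s / T).
rewrite ler_pdivlMr// ltr_pdivrMr// intrD mulrDl mul1r => /andP[h1 h2].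
by rewrite mulrNz -mulrzr mulrC; apply/andP; split; lra.
Qed.

End period.

(** * Tonelli's theorem on the torus, with the offset as a coordinate *)

Section tonelli_torus.
Set Implicit Arguments.
Unset Strict Implicit.
Context (R : realType).
Local Open Scope ereal_scope.
Local Notation mu := (@lebesgue_measure R).
Local Notation T := (@pi R *+ 2)%R.

Lemma integral_restrict_rect (D1 D2 : set R) (f : R * R -> \bar R) :
  \int[mu]_x \int[mu]_y (f \_ (D1 `*` D2)) (x, y) =
  \int[mu]_(x in D1) \int[mu]_(y in D2) f (x, y).
Proof.
rewrite [RHS]integral_mkcond; apply: eq_integral => x _.
rewrite [RHS]patchE; case: ifPn => [/set_mem Dx|/negP nDx].
  rewrite [RHS]integral_mkcond; apply: eq_integral => y _.
  rewrite !patchE; case: ifPn => [/set_mem[_ /= Dy]|/negP nDxy].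
    by rewrite mem_set.
  by rewrite memNset// => Dy; apply: nDxy; apply/mem_set.
apply: integral0_eq => y _; rewrite patchE ifN//.
by apply/negP => /set_mem[/= Dx _]; apply: nDx; apply/mem_set.
Qed.

Lemma measurable_restrict_rect (D1 D2 : set R) (f : R * R -> \bar R) :
  measurable D1 -> measurable D2 -> measurable_fun setT f ->
  measurable_fun setT (f \_ (D1 `*` D2)).
Proof.
move=> mD1 mD2 mf; apply/(measurable_restrictT _ _).1; first exact: measurableX.
exact: measurable_funS mf.
Qed.

Lemma tonelli_rect (D1 D2 : set R) (f : R * R -> \bar R) :
  measurable D1 -> measurable D2 -> measurable_fun setT f ->
  (forall z, 0 <= f z) ->
  \int[mu \x mu]_(z in D1 `*` D2) f z =
    \int[mu]_(x in D1) \int[mu]_(y in D2) f (x, y).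
Proof.
move=> mD1 mD2 mf f0; rewrite integral_mkcond fubini_tonelli1.
- exact: integral_restrict_rect.
- exact: measurable_restrict_rect.
- by move=> z; rewrite patchE; case: ifPn.
Qed.

Lemma tonelli_swap (D1 D2 : set R) (f : R * R -> \bar R) :
  measurable D1 -> measurable D2 -> measurable_fun setT f ->
  (forall z, 0 <= f z) ->
  \int[mu]_(x in D1) \int[mu]_(y in D2) f (x, y) =
  \int[mu]_(y in D2) \int[mu]_(x in D1) f (x, y).
Proof.
move=> mD1 mD2 mf f0; rewrite -integral_restrict_rect fubini_tonelli.
- rewrite -(integral_restrict_rect _ _ (fun z => f (z.2, z.1))).
  apply: eq_integral => y _; apply: eq_integral => x _; rewrite !patchE.
  by congr (if _ then _ else _); apply/idP/idP; rewrite !inE/= => -[].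
- exact: measurable_restrict_rect.
- by move=> z; rewrite patchE; case: ifPn.
Qed.

Lemma measurable_shift (s : R) :
  measurable_fun setT ((fun x => x + s)%R : measurableTypeR R -> measurableTypeR R).
Proof. exact: measurable_funD. Qed.

Lemma lebesgue_measure_shift (s : R) (A : set R) : measurable A ->
  pushforward mu ((fun x => x + s)%R : _ -> measurableTypeR R) A = mu A.
Proof.
move=> mA; apply/esym/lebesgue_measure_unique => //=.
  exact: measurable_shift.
move=> ms _ [[a b]] _ <-.
rewrite /pushforward.
have -> : (fun x => x + s)%R @^-1` `]a, b]%classic = `](a - s)%R, (b - s)%R]%classic.
  by apply/seteqP; split => x /=; rewrite !in_itv/= ltrBlDr lerBrDr.
rewrite !lebesgue_measure_itv/= !lte_fin ltrD2r -!EFinD.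
by rewrite (_ : (b - s - (a - s) = b - a)%R)//; ring.
Qed.

Lemma ge0_integral_shift (s : R) (A : set R) (f : R -> \bar R) : measurable A ->
  measurable_fun setT f -> (forall x, 0 <= f x) ->
  \int[mu]_(x in (fun x => x + s)%R @^-1` A) f (x + s)%R = \int[mu]_(x in A) f x.
Proof.
move=> mA mf f0.
have := @ge0_integral_pushforward _ _ _ (measurableTypeR R) R
  ((fun x => x + s)%R : measurableTypeR R -> measurableTypeR R) (measurable_shift s) mu A f mA.
move=> <-//; last exact: measurable_funS mf.
apply: eq_measure_integral => [|ms B mB _]; first exact: measurable_shift.
exact: lebesgue_measure_shift.
Qed.

(** Only [s] modulo the period matters. For [0 <= r < T] the translated period [[r, T + r[] is cut
    at [T], and its second piece is moved back by one period. *)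
Lemma ge0_integral_period (s : R) (f : R -> \bar R) :
  (forall x, f (x + T)%R = f x) ->
  measurable_fun setT f -> (forall x, 0 <= f x) ->
  \int[mu]_(x in `[0%R, T[) f (x + s)%R = \int[mu]_(x in `[0%R, T[) f x.
Proof.
move=> fT mf f0.
have [k /andP[r0 rT]] := period_representative s.
set r := (s + _)%R in r0 rT.
under eq_integral => x _.
  rewrite (_ : (x + s = (x + r) + T *~ (- k))%R); last by rewrite /r mulrNz addrA addrK.
  rewrite periodicMz//.
  over.
rewrite [in LHS](_ : `[0%R, T[%classic = (fun x => x + r)%R @^-1` `[r, (T + r)%R[%classic); last first.
  by apply/seteqP; split => x /=; rewrite !in_itv/= lerDr ltrD2r.
rewrite ge0_integral_shift//.
have -> : `[r, (T + r)%R[%classic = `[r, T[ `|` `[T, (T + r)%R[.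
  by rewrite -itv_bndbnd_setU// bnd_simp ?lerDl// ltW.
rewrite ge0_integral_setU//=; last 2 first.
- exact: measurable_funS mf.
- rewrite disj_set2E; apply/eqP/seteqP; split => x//=; rewrite !in_itv/= => -[].
  by move=> /andP[_ xT] /andP[Tx _]; move: xT; rewrite ltNge Tx.
rewrite -[in X in _ + X](@ge0_integral_shift T)//.
have -> : (fun x => x + T)%R @^-1` `[T, (T + r)%R[%classic = `[0%R, r[%classic.
  by apply/seteqP; split => x /=; rewrite !in_itv/= lerDr (addrC T) ltrD2r.
under [X in _ + X]eq_integral do rewrite fT.
rewrite addeC -ge0_integral_setU//=; last 2 first.
- exact: measurable_funS mf.
- rewrite disj_set2E; apply/eqP/seteqP; split => x//=; rewrite !in_itv/= => -[].
  by move=> /andP[_ xT] /andP[Tx _]; move: xT; rewrite ltNge Tx.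
by rewrite -itv_bndbnd_setU// bnd_simp// ltW.
Qed.

(** For fixed [s] the inner period is translated by [s], so that the second variable becomes the
    offset; then the order of integration is exchanged. *)
Lemma integral_torus_shear (f : R * R -> \bar R) :
  measurable_fun setT f -> (forall z, 0 <= f z) ->
  (forall s t, f (s, (t + T)%R) = f (s, t)) ->
  \int[mu \x mu]_(z in @torus R) f z =
    \int[mu]_(y in `[0%R, T[) \int[mu]_(s in `[0%R, T[) f (s, (s + y)%R).
Proof.
move=> mf f0 fT; rewrite tonelli_rect//.
pose g (z : R * R) := f (z.1, (z.1 + z.2)%R).
have mg : measurable_fun setT g.
  apply: measurableT_comp => //; apply: measurable_fun_pair => //.
  by apply: measurable_funD.
transitivity (\int[mu]_(s in `[0%R, T[) \int[mu]_(y in `[0%R, T[) g (s, y)).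
  apply: eq_integral => s _.
  rewrite -(@ge0_integral_period s (fun t => f (s, t)))//.
    by apply: eq_integral => y _; rewrite /g /= addrC.
  by apply: measurableT_comp.
by rewrite tonelli_swap// => z; exact: f0.
Qed.

End tonelli_torus.

(** * Euclidean inner product and norm *)

Section euclidean.
Set Implicit Arguments.
Unset Strict Implicit.
Context (R : realType) (n : nat).
Implicit Types (u v w : 'rV[R]_n) (a : R).

Lemma dotmulC u v : dotmul u v = dotmul v u.
Proof. by apply: eq_bigr => i _; rewrite mulrC. Qed.

Lemma dotmulDl u v w : dotmul (u + v) w = dotmul u w + dotmul v w.
Proof. by rewrite -big_split; apply: eq_bigr => i _; rewrite mxE mulrDl. Qed.

Lemma dotmulZl a u v : dotmul (a *: u) v = a * dotmul u v.
Proof. by rewrite mulr_sumr; apply: eq_bigr => i _; rewrite mxE mulrA. Qed.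

Lemma dotmulDr u v w : dotmul u (v + w) = dotmul u v + dotmul u w.
Proof. by rewrite !(dotmulC u) dotmulDl. Qed.

Lemma dotmulZr a u v : dotmul u (a *: v) = a * dotmul u v.
Proof. by rewrite !(dotmulC u) dotmulZl. Qed.

Lemma dotmulNl u v : dotmul (- u) v = - dotmul u v.
Proof. by rewrite -scaleN1r dotmulZl mulN1r. Qed.

Lemma dotmulNr u v : dotmul u (- v) = - dotmul u v.
Proof. by rewrite !(dotmulC u) dotmulNl. Qed.

Lemma dotmul_ge0 u : 0 <= dotmul u u.
Proof. by apply: sumr_ge0 => i _; rewrite -expr2 sqr_ge0. Qed.

Lemma dotmul_eq0 u : dotmul u u = 0 -> u = 0.
Proof.
move/eqP; rewrite psumr_eq0 => [/allP u0|i _]; last by rewrite -expr2 sqr_ge0.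
apply/rowP => i; rewrite mxE; apply/eqP.
by have := u0 i; rewrite mem_index_enum mulf_eq0 orbb => /(_ erefl).
Qed.

Lemma enorm_ge0 u : 0 <= enorm u. Proof. exact: sqrtr_ge0. Qed.

Lemma sqr_enorm u : enorm u ^+ 2 = dotmul u u.
Proof. by rewrite sqr_sqrtr// dotmul_ge0. Qed.

Lemma enorm_eq0 u : enorm u = 0 -> u = 0.
Proof. by move=> u0; apply: dotmul_eq0; rewrite -sqr_enorm u0 expr0n. Qed.

Lemma enorm0 : enorm (0 : 'rV[R]_n) = 0.
Proof. by rewrite /enorm /dotmul big1 ?sqrtr0// => i _; rewrite mxE mul0r. Qed.

Lemma enormZ a u : enorm (a *: u) = `|a| * enorm u.
Proof.
by rewrite /enorm dotmulZl dotmulZr mulrA -expr2 sqrtrM ?sqr_ge0// sqrtr_sqr.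
Qed.

Lemma enormN u : enorm (- u) = enorm u.
Proof. by rewrite -scaleN1r enormZ normrN1 mul1r. Qed.

Lemma enormB u v : enorm (u - v) = enorm (v - u).
Proof. by rewrite -enormN opprB. Qed.

Lemma sqr_enormB u v : enorm (u - v) ^+ 2 = dotmul u u - dotmul u v *+ 2 + dotmul v v.
Proof.
rewrite sqr_enorm !(dotmulDl, dotmulDr, dotmulNl, dotmulNr) (dotmulC v u).
ring.
Qed.

Lemma cauchy_schwarz u v : dotmul u v <= enorm u * enorm v.
Proof.
have [u0|u0] := eqVneq (enorm u) 0.
  by rewrite u0 mul0r (enorm_eq0 u0) /dotmul big1// => i _; rewrite mxE mul0r.
have [v0|v0] := eqVneq (enorm v) 0.
  by rewrite v0 mulr0 (enorm_eq0 v0) /dotmul big1// => i _; rewrite mxE mulr0.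
have pu : 0 < enorm u by rewrite lt_def u0 enorm_ge0.
have pv : 0 < enorm v by rewrite lt_def v0 enorm_ge0.
have := dotmul_ge0 (enorm v *: u - enorm u *: v).
rewrite -sqr_enorm sqr_enormB !(dotmulZl, dotmulZr) -!sqr_enorm.
have := mulr_gt0 pu pv.
move: (enorm u) (enorm v) (dotmul u v) => x y z xy0 h.
have {}h : 0 <= (x * y) * (x * y - z) by lra.
by rewrite -subr_ge0 -(pmulr_rge0 _ xy0).
Qed.

Lemma enormD u v : enorm (u + v) <= enorm u + enorm v.
Proof.
rewrite -ler_sqr ?nnegrE ?addr_ge0 ?enorm_ge0// sqr_enorm.
rewrite !(dotmulDl, dotmulDr) (dotmulC v u) -!sqr_enorm.
have := cauchy_schwarz u v; lra.
Qed.

Lemma enorm_dist_triangle u v w : enorm (u - w) <= enorm (u - v) + enorm (v - w).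
Proof. by apply: le_trans (enormD _ _); rewrite addrA subrK. Qed.

(** Weights of sum zero make the combination invariant under translation, so its square depends on
    mutual distances only. In each coordinate this is a polynomial identity. *)
Lemma dotmul_four_points (a0 a1 a2 a3 : R) (x0 x1 x2 x3 : 'rV[R]_n) :
  a0 + a1 + a2 + a3 = 0 ->
  enorm (a0 *: x0 + a1 *: x1 + a2 *: x2 + a3 *: x3) ^+ 2 =
  - (a0 * a1 * enorm (x0 - x1) ^+ 2 + a0 * a2 * enorm (x0 - x2) ^+ 2
   + a0 * a3 * enorm (x0 - x3) ^+ 2 + a1 * a2 * enorm (x1 - x2) ^+ 2
   + a1 * a3 * enorm (x1 - x3) ^+ 2 + a2 * a3 * enorm (x2 - x3) ^+ 2).
Proof.
move=> a_sum; have -> : a3 = - (a0 + a1 + a2) by lra.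
rewrite !sqr_enorm /dotmul !mulr_sumr -!big_split -sumrN/=.
by apply: eq_bigr => i _; rewrite !mxE; ring.
Qed.

End euclidean.

(** * Absolutely continuous unit-speed curves are 1-Lipschitz *)

Section unit_speed_lipschitz.
Set Implicit Arguments.
Unset Strict Implicit.
Context (R : realType) (n : nat).
Implicit Types (a b : R) (c : R -> 'rV[R]_n).

(** The supremum of the points where [P] holds is approached from the left and passed on the right
    by the same local step, since [u] and [v] lie on either side of [t]. *)
Lemma real_induction a b (P : R -> Prop) : a <= b -> P a ->
  (forall t, a <= t <= b -> exists2 eta, 0 < eta & forall u v,
     a <= u <= t -> t <= v <= b -> t - eta < u -> v < t + eta -> P u -> P v) ->
  P b.
Proof.
move=> ab Pa step; pose S := [set x | a <= x <= b /\ P x].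
have Sa : S a by split => //; rewrite lexx.
have hS : has_sup S by split; [exists a|exists b => x [/andP[]]].
have supab : a <= sup S <= b.
  apply/andP; split; first by apply: ub_le_sup Sa; case: hS.
  by apply: ge_sup; [exists a|move=> x [/andP[]]].
have [eta eta0 step_sup] := step _ supab.
have [u [/andP[au ub] Pu] supu] := sup_adherent eta0 hS.
have us : u <= sup S by apply: ub_le_sup; [case: hS|split=> //; rewrite au].
have Pv v : sup S <= v <= b -> v < sup S + eta -> P v.
  by move=> sv vs; apply: (step_sup u v) => //; rewrite au.
have [sb|sb] := leP b (sup S).
  by apply: Pv; [case/andP: supab => _ ->; rewrite lexx|lra].
pose v := Num.min b (sup S + eta / 2).
have sv : sup S < v by rewrite lt_min sb ltrDl; lra.
have vb : v <= b by rewrite ge_min lexx.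
have Sv : S v.
  split; first by apply/andP; split => //; lra.
  apply: Pv; first by rewrite ltW.
  by rewrite /v gt_min; apply/orP; right; lra.
have : v <= sup S by apply: ub_le_sup Sv; case: hS.
by rewrite leNgt sv.
Qed.

Lemma enorm_continuous : continuous (@enorm R n).
Proof.
move=> u; apply: (@continuous_comp _ _ _ (fun u : 'rV[R]_n => dotmul u u) Num.sqrt).
  have FF : Filter (nbhs u) by exact: nbhs_filter.
  apply: (@cvg_big R^o _ _ _ _ (@add_continuous R^o) _ (nbhs u)) => i _.
  by apply: cvgM; exact: coord_continuous.
exact: sqrt_continuous.
Qed.

Lemma derivable_enorm_near c t (e : R) : derivable c t 1 -> 0 < e ->
  exists2 eta, 0 < eta & forall s, `|s - t| < eta ->
    `|enorm (c s - c t) - enorm (derive1 c t) * `|s - t| | <= e * `|s - t|.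
Proof.
move=> dc e0.
have : h^-1 *: ((c \o shift t) (h *: 1) - c t) @[h --> 0^'] --> derive1 c t.
  by rewrite derive1E; exact: dc.
move=> /cvg_comp /(_ (@enorm_continuous (derive1 c t))).
move=> /cvgrPdist_lt /(_ _ e0) [eta /= eta0 near_t].
exists eta => // s st.
have [->|s_neq_t] := eqVneq s t.
  by rewrite !subrr enorm0 normr0 !mulr0 subrr normr0.
have st0 : 0 < `|s - t| by rewrite normr_gt0 subr_eq0.
have := near_t (s - t); rewrite /= sub0r normrN subr_eq0 => /(_ st s_neq_t).
rewrite /= /shift/= [_ *: 1]mulr1 subrK enormZ normfV => /ltW.
rewrite -(ler_pM2r st0) -{2}(gtr0_norm st0) -normrM mulrBl.
by rewrite mulrAC mulVf ?gt_eqF// mul1r distrC.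
Qed.

Definition extend (V : Type) (m : nat) (x : 'I_m -> V) (u : V) (i : 'I_m.+1) : V :=
  if unlift ord0 i is Some j then x j else u.

Lemma extend0 (V : Type) (m : nat) (x : 'I_m -> V) u : extend x u ord0 = u.
Proof. by rewrite /extend unlift_none. Qed.

Lemma extend_lift (V : Type) (m : nat) (x : 'I_m -> V) u i :
  extend x u (lift ord0 i) = x i.
Proof. by rewrite /extend liftK. Qed.

Lemma sum_itv_lt (m : nat) (x y : 'I_m -> R) (U : set R) (d : R) :
  (forall i, x i <= y i) ->
  (forall i, `]x i, y i[%classic `<=` U) ->
  trivIset [set: 'I_m] (fun i => `]x i, y i[%classic) ->
  open U -> (lebesgue_measure U < d%:E)%E -> \sum_(i < m) (y i - x i) < d.
Proof.
move=> xy xyU tI oU Ud; rewrite -lte_fin; apply: le_lt_trans Ud.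
rewrite -sumEFin (eq_bigr (fun i => lebesgue_measure `]x i, y i[%classic)); last first.
  move=> i _; rewrite lebesgue_measure_itv/= lte_fin -EFinB.
  by case: ltgtP (xy i) => // ->; rewrite subrr.
rewrite -measure_bigsetU_ord//; apply: le_measure; rewrite ?inE.
- by apply: bigsetU_measurable => i _; exact: measurable_itv.
- exact: open_measurable.
- by apply: (big_ind (fun A => A `<=` U)) => // A B AU BU z [/AU|/BU].
Qed.

Lemma null_set_open_cover (N : set R) (d : R) : measurable N ->
  lebesgue_measure N = 0%E -> 0 < d ->
  exists U, [/\ open U, N `<=` U & (lebesgue_measure U < d%:E)%E].
Proof.
move=> mN N0 d0.
have Noo : (lebesgue_measure N < +oo)%E by rewrite N0 ltry.
have [U [oU NU UN]] := lebesgue_regularity_outer mN Noo d0.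
exists U; split => //; apply: le_lt_trans UN; have mU := open_measurable oU.
rewrite (measureDI lebesgue_measure mU mN).
rewrite [X in (_ + X)%E](_ : _ = 0%E) ?adde0//; apply/eqP.
rewrite eq_le measure_ge0 andbT -N0; apply: le_measure; rewrite ?inE//.
exact: measurableI.
Qed.

(** Real induction along [[a, b]]. Up to [t] the displacement is bounded by [(1 + e) * (t - a)] plus
    the jumps over finitely many disjoint intervals inside an open set [U] of measure below [d] that
    contains the exceptional null set. Points of speed 1 feed the first term, exceptional points add
    an interval; absolute continuity bounds the jumps by [e]. *)
Lemma unit_speed_lipschitz_itv a b c : a <= b -> abs_continuous a b c ->
  {ae @lebesgue_measure R,
    forall t, derivable c t 1 /\ enorm (derive1 c t) = 1} ->
  enorm (c b - c a) <= b - a.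
Proof.
move=> ab ac [N [mN N0 badN]].
suff le_eps e : 0 < e -> enorm (c b - c a) <= (1 + e) * (b - a) + e.
  apply/ler_addgt0Pr => e e0.
  pose e' := e / (1 + (b - a)).
  have e'0 : 0 < e' by rewrite divr_gt0//; lra.
  apply: le_trans (le_eps _ e'0) _.
  rewrite (_ : _ + e' = b - a + e)// /e'; field; lra.
move=> e0; have [d d0 acd] := ac e e0.
have [U [oU NU Ud]] := null_set_open_cover mN N0 d0.
pose P t := exists m (x y : 'I_m -> R),
  [/\ forall i, a <= x i /\ x i <= y i /\ y i <= t,
      forall i, `]x i, y i[%classic `<=` U,
      trivIset [set: 'I_m] (fun i => `]x i, y i[%classic) &
      enorm (c t - c a) <= (1 + e) * (t - a) + \sum_(i < m) enorm (c (y i) - c (x i))].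
suff [m [x [y [xyb xyU tI cb]]]] : P b.
  apply: le_trans cb _; rewrite lerD2l ltW// acd//.
  by apply: sum_itv_lt Ud => // i; have [_ []] := xyb i.
apply: (real_induction ab).
  exists 0%N, (fun=> a), (fun=> a); split => [[]//|[]//|[]//|].
  by rewrite big_ord0 !subrr enorm0 mulr0 addr0.
move=> t /andP[at_ tb].
have [Nt|nNt] := pselect (N t).
  (* At an exceptional point []u, v[] stays inside [U] and is recorded as one more interval, at
     index 0. *)
  have /nbhs_ballP[eta eta0 ball_U] := open_nbhs_nbhs (conj oU (NU _ Nt)).
  exists eta => // u v /andP[au ut] /andP[tv vb] etau etav [m [x [y [xyu xyU tI cu]]]].
  have uvU : `]u, v[%classic `<=` U.
    move=> z; rewrite /= in_itv/= => /andP[uz zv]; apply: ball_U.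
    by rewrite /ball/= ltr_distlC; lra.
  have uv := le_trans ut tv.
  exists m.+1, (extend x u), (extend y v); split.
  - move=> i; case: (unliftP ord0 i) => [j|] ->; rewrite ?extend_lift ?extend0//.
    by have [? []] := xyu j; lra.
  - by move=> i; case: (unliftP ord0 i) => [j|] ->; rewrite ?extend_lift ?extend0.
  - move=> i j _ _; case: (unliftP ord0 i) => [i'|] ->; case: (unliftP ord0 j) => [j'|] ->;
      rewrite ?extend_lift ?extend0//.
    + by move=> ne; congr lift; apply: tI.
    + move=> [z [/=]]; rewrite !in_itv/= => /andP[_ zy] /andP[uz _].
      by exfalso; have [_ [_ yu]] := xyu i'; lra.
    + move=> [z [/=]]; rewrite !in_itv/= => /andP[uz _] /andP[_ zy].
      by exfalso; have [_ [_ yu]] := xyu j'; lra.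
  - rewrite big_ord_recl !extend0.
    under eq_bigr do rewrite !extend_lift.
    apply: le_trans (enorm_dist_triangle _ (c u) _) _.
    have : 0 <= e * (v - u) by apply: mulr_ge0; [exact: ltW|rewrite subr_ge0].
    lra.
have [dct ct1] : derivable c t 1 /\ enorm (derive1 c t) = 1.
  by apply: contrapT => /badN.
have [eta eta0 near_t] := derivable_enorm_near dct e0.
exists eta => // u v /andP[au ut] /andP[tv vb] etau etav [m [x [y [xyu xyU tI cu]]]].
exists m, x, y; split => //.
  by move=> i; have [? []] := xyu i; lra.
have {}near_t s : `|s - t| < eta -> enorm (c s - c t) <= (1 + e) * `|s - t|.
  by move=> /near_t; rewrite ct1 mul1r ler_norml => /andP[_]; lra.
have hv : enorm (c v - c t) <= (1 + e) * (v - t).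
  by have := near_t v; rewrite ger0_norm ?subr_ge0// => -> //; lra.
have hu : enorm (c t - c u) <= (1 + e) * (t - u).
  rewrite enormB; have := near_t u; rewrite distrC ger0_norm ?subr_ge0// => -> //; lra.
apply: le_trans (enorm_dist_triangle _ (c u) _) _.
have := enorm_dist_triangle (c v) (c t) (c u); lra.
Qed.

End unit_speed_lipschitz.

(** * The distance along the circle *)

Section circle_distance.
Set Implicit Arguments.
Unset Strict Implicit.
Context (R : realType).
Implicit Types (s t x y : R) (k : int).
Local Notation T := (@pi R *+ 2).

Lemma circle_dist_le s t k : circle_dist s t <= `|s - t + T *~ k|.
Proof.
apply: ge_inf; last by exists k.
by exists 0 => _ [j _ <-]; exact: normr_ge0.
Qed.

Lemma le_circle_dist m s t : (forall k, m <= `|s - t + T *~ k|) ->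
  m <= circle_dist s t.
Proof.
move=> mk; apply: lb_le_inf; first by exists `|s - t + T *~ 0|, 0.
by move=> _ [k _ <-].
Qed.

Lemma near_representative x : exists k, `|x + T *~ k| <= pi.
Proof.
have [k /andP[k0 kT]] := period_representative (x + pi).
by exists k; rewrite ler_norml; lra.
Qed.

(** Any other representative differs by at least [T], so its absolute value is at least
    [T - pi = pi]. *)
Lemma circle_distE s t k : `|s - t + T *~ k| <= pi ->
  circle_dist s t = `|s - t + T *~ k|.
Proof.
move=> k_pi; apply/eqP; rewrite eq_le circle_dist_le/=.
apply: le_circle_dist => j; have [->//|jk] := eqVneq j k.
apply: (le_trans (k_pi)).
have : T <= `|T *~ (j - k)|.
  have T0 : 0 <= T by rewrite mulrn_wge0 ?pi_ge0.
  rewrite -mulrzr normrM (ger0_norm T0) ler_peMr//.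
  by rewrite -intr_norm ler1z -gtz0_ge1 normr_gt0 subr_eq0.
rewrite mulrzBr => Tjk.
have := ler_normB (s - t + T *~ j) (s - t + T *~ k).
rewrite (_ : s - t + T *~ j - _ = T *~ j - T *~ k); last by ring.
move: k_pi; lra.
Qed.

Lemma circle_distP s t : exists2 k, circle_dist s t = `|s - t + T *~ k| &
  `|s - t + T *~ k| <= pi.
Proof.
by have [k kpi] := near_representative (s - t); exists k => //; exact: circle_distE.
Qed.

Lemma circle_dist_ge0 s t : 0 <= circle_dist s t.
Proof. by apply: le_circle_dist => k. Qed.

Lemma circle_dist_le_pi s t : circle_dist s t <= pi.
Proof. by have [k ->] := circle_distP s t. Qed.

Lemma circle_dist_shift s t : circle_dist s t = circle_dist 0 (t - s).
Proof. by rewrite /circle_dist; under [in RHS]eq_imagel do rewrite sub0r opprB. Qed.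

Lemma circle_dist_periodic s t : circle_dist s (t + T) = circle_dist s t.
Proof.
have [k -> kpi] := circle_distP s (t + T).
have e : s - (t + T) + T *~ k = s - t + T *~ (k - 1).
  by rewrite mulrzBr mulr1z; ring.
by rewrite e -circle_distE// -e.
Qed.

Lemma circle_dist0_small y : 0 <= y <= pi -> circle_dist 0 y = y.
Proof.
move=> /andP[y0 ypi]; rewrite (@circle_distE _ _ 0) mulr0z addr0 sub0r normrN ger0_norm//.
Qed.

Lemma circle_dist0_large y : pi <= y <= T -> circle_dist 0 y = T - y.
Proof.
move=> /andP[ypi yT].
by rewrite (@circle_distE _ _ 1) mulr1z sub0r addrC ger0_norm; lra.
Qed.

Lemma cos_circle_dist s t : cos (circle_dist s t) = cos (s - t).
Proof.
have [k -> _] := circle_distP s t; rewrite cos_norm.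
exact: (@periodicMz _ _ (@cos R) k (@cosD2pi R)).
Qed.

Lemma circle_dist_lipschitz x y : `|circle_dist 0 x - circle_dist 0 y| <= `|x - y|.
Proof.
have le1 (a b : R) : circle_dist 0 a <= circle_dist 0 b + `|a - b|.
  have [k -> _] := circle_distP 0 b.
  apply: le_trans (circle_dist_le 0 a k) _; rewrite distrC.
  apply: le_trans (ler_normD _ _); rewrite le_eqVlt; apply/orP; left; apply/eqP.
  by congr (`|_|); ring.
have := le1 x y; have := le1 y x; rewrite (distrC y) ler_norml; lra.
Qed.

Lemma circle_dist_continuous : continuous (circle_dist (0 : R)).
Proof.
move=> x; apply/cvgrPdist_le => /= e e0; near=> y.
apply: le_trans (circle_dist_lipschitz _ _) _.
near: y; exact: cvgr_dist_le.
Unshelve. all: by end_near.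
Qed.

End circle_distance.

(** * Chords are at most the distance along the curve *)

Section global_lipschitz.
Set Implicit Arguments.
Unset Strict Implicit.
Context (R : realType) (n : nat) (c : R -> 'rV[R]_n).
Local Notation T := (@pi R *+ 2).
Hypothesis cc : closed_unit_speed c.

Lemma closed_unit_speed_periodic x : c (x + T) = c x.
Proof. by case: cc => + _ _; exact. Qed.

Lemma unit_speed_lipschitz_period s t : 0 <= s -> s <= t -> t <= T ->
  enorm (c t - c s) <= t - s.
Proof.
move=> s0 st tT; case: cc => _ ac speed; apply: unit_speed_lipschitz_itv => //.
move=> e /ac[d d0 acd]; exists d => // m x y xy; apply: acd => i.
by have [? []] := xy i; lra.
Qed.

Lemma unit_speed_lipschitz s t : enorm (c s - c t) <= `|s - t|.
Proof.
wlog st : s t / s <= t => [hw|].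
  have [/hw//|/ltW/hw] := leP s t; by rewrite enormB distrC.
rewrite enormB distrC ger0_norm ?subr_ge0//.
have [j /andP[s0 sT]] := period_representative s.
have cM k := periodicMz k closed_unit_speed_periodic.
have T0 : 0 <= T by rewrite mulrn_wge0 ?pi_ge0.
have [i /andP[t0 tT]] := period_representative (t + T *~ j).
rewrite -(cM j s) -(cM j t) -(cM i (t + _)).
have -> : t - s = t + T *~ j - (s + T *~ j) by ring.
set s' := s + _ in s0 sT *; set t' := t + _ in t0 tT *.
have s't' : s' <= t' by rewrite lerD2r.
(* [- i] counts the periods between [s'] and [t']. It cannot be negative because [s' <= t']; if it
   is positive, the path is broken at the common point [c 0 = c T]. *)
have [i0|i0|i0] := ltrgt0P i.
- have : 0 <= T *~ (i - 1) by rewrite mulrz_ge0// subr_ge0 -gtz0_ge1.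
  rewrite mulrzBr mulr1z; move: s0 s't' tT; lra.
- have : 0 <= T *~ (- i - 1).
    by rewrite mulrz_ge0// subr_ge0 -gtz0_ge1 oppr_gt0.
  rewrite mulrzBr mulr1z mulrNz.
  have := @unit_speed_lipschitz_period s' T s0 (ltW sT) (lexx _).
  have := @unit_speed_lipschitz_period 0 (t' + T *~ i) (lexx _) t0 (ltW tT).
  have := enorm_dist_triangle (c (t' + T *~ i)) (c 0) (c s').
  have := closed_unit_speed_periodic 0; rewrite add0r => ->.
  lra.
- rewrite i0 mulr0z addr0 in tT *.
  exact: unit_speed_lipschitz_period (ltW tT).
Qed.

Lemma enorm_le_circle_dist s t : enorm (c s - c t) <= circle_dist s t.
Proof.
apply: le_circle_dist => k.
rewrite -(periodicMz k closed_unit_speed_periodic s).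
rewrite (_ : s - t + _ = s + T *~ k - t); last by ring.
exact: unit_speed_lipschitz.
Qed.

End global_lipschitz.

(** * Taylor bounds for sine and cosine *)

Section trigonometric_bounds.
Set Implicit Arguments.
Unset Strict Implicit.
Context (R : realType).
Implicit Types (a b x y : R).

Lemma le_of_derive (f g df dg : R -> R) a b : a <= b ->
  (forall x, is_derive x 1 f (df x)) -> (forall x, is_derive x 1 g (dg x)) ->
  (forall x, a < x < b -> df x <= dg x) -> f b - f a <= g b - g a.
Proof.
move=> ab f_df g_dg le_d; have [<-|anb] := eqVneq a b; first by rewrite !subrr.
have {anb} ab' : a < b by rewrite lt_def eq_sym anb.
have [x] : exists2 x, x \in `]a, b[ & (g - f) b - (g - f) a = (dg x - df x) * (b - a).
  apply: (@MVT R (g - f) (fun x => dg x - df x)) => //.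
  apply: derivable_within_continuous => x _.
  exact: (@ex_derive _ _ _ _ _ _ _ (is_deriveB (g_dg x) (f_df x))).
rewrite in_itv/= => /le_d d0.
rewrite !fctE => e; have : 0 <= (dg x - df x) * (b - a) by rewrite mulr_ge0 ?subr_ge0.
by rewrite -e; lra.
Qed.

Lemma lt_of_derive (f g df dg : R -> R) a b : a < b ->
  (forall x, is_derive x 1 f (df x)) -> (forall x, is_derive x 1 g (dg x)) ->
  (forall x, a < x < b -> df x < dg x) -> f b - f a < g b - g a.
Proof.
move=> ab f_df g_dg lt_d.
have [x] : exists2 x, x \in `]a, b[ & (g - f) b - (g - f) a = (dg x - df x) * (b - a).
  apply: (@MVT R (g - f) (fun x => dg x - df x)) => //.
  apply: derivable_within_continuous => x _.
  exact: (@ex_derive _ _ _ _ _ _ _ (is_deriveB (g_dg x) (f_df x))).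
rewrite in_itv/= => /lt_d d0.
rewrite !fctE => e; have : 0 < (dg x - df x) * (b - a) by rewrite mulr_gt0 ?subr_gt0.
by rewrite -e; lra.
Qed.

(** Start of a chain of Taylor bounds: each one gives the next by comparison of derivatives from
    0. *)
Lemma sin_le_id x : 0 <= x -> sin x <= x.
Proof.
move=> x0; suff : sin x - sin 0 <= x - 0 by rewrite sin0 !subr0.
apply: (@le_of_derive sin id cos (fun=> 1)) => // y _; apply: cos_le1.
Qed.

Lemma cos_ge_quadratic x : 0 <= x -> 1 - x ^+ 2 / 2 <= cos x.
Proof.
move=> x0.
suff : x ^+ 2 / (-2) - 0 ^+ 2 / (-2) <= cos x - cos 0 by rewrite cos0; lra.
apply: (@le_of_derive (fun x => x ^+ 2 / (-2)) cos (fun x => - x) (fun x => - sin x)) => //.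
  by move=> y; apply: is_derive_eq; rewrite !scaler0 ?addr0 /GRing.scale/=; lra.
by move=> y /andP[y0 _]; rewrite lerN2 sin_le_id// ltW.
Qed.

Lemma sin_ge_cubic x : 0 <= x -> x - x ^+ 3 / 6 <= sin x.
Proof.
move=> x0.
suff : x - x ^+ 3 / 6 - (0 - 0 ^+ 3 / 6) <= sin x - sin 0.
  by rewrite sin0; lra.
apply: (@le_of_derive (fun x => x - x ^+ 3 / 6) sin (fun x => 1 - x ^+ 2 / 2) cos) => //.
  by move=> y; apply: is_derive_eq; rewrite !scaler0 ?addr0 /GRing.scale/=; lra.
by move=> y /andP[y0 _]; rewrite cos_ge_quadratic// ltW.
Qed.

Lemma cos_le_quartic x : 0 <= x -> cos x <= 1 - x ^+ 2 / 2 + x ^+ 4 / 24.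
Proof.
move=> x0.
suff : cos x - cos 0 <= x ^+ 4 / 24 - x ^+ 2 / 2 - (0 ^+ 4 / 24 - 0 ^+ 2 / 2).
  by rewrite cos0; lra.
apply: (@le_of_derive cos (fun x => x ^+ 4 / 24 - x ^+ 2 / 2) (fun x => - sin x)
  (fun x => x ^+ 3 / 6 - x)) => //.
  by move=> y; apply: is_derive_eq; rewrite !scaler0 ?addr0 /GRing.scale/=; lra.
by move=> y /andP[y0 _]; have := sin_ge_cubic (ltW y0); lra.
Qed.

(** The quartic bound already makes [cos (8 / 5)] negative, hence [pi / 2 < 8 / 5]. *)
Lemma pi_lt_16_5 : pi < 16 / 5 :> R.
Proof.
have c8 : cos (8 / 5) < 0 :> R.
  by apply: le_lt_trans (cos_le_quartic _) _; lra.
rewrite ltNge; apply/negP => pi_ge.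
have : 0 <= cos (8 / 5 : R) by apply: cos_ge0_pihalf; lra.
by rewrite leNgt c8.
Qed.

Lemma cos_lt_cos x y : 0 <= x -> x < y -> y <= pi -> cos y < cos x.
Proof.
move=> x0 xy ypi.
by rewrite ltr_cos ?in_itv/= ?x0 ?ypi ?(le_trans _ ypi) ?(le_trans x0) ?ltW.
Qed.

Lemma sqr_sub_chord_le y : 0 <= y -> y ^+ 2 - (2 - 2 * cos y) <= y ^+ 4 / 12.
Proof. by move=> /cos_le_quartic; lra. Qed.

Lemma chord_le_sqr y : 0 <= y -> 2 - 2 * cos y <= y ^+ 2.
Proof. by move=> /cos_ge_quadratic; lra. Qed.

Lemma chord_gt0 y : 0 < y <= pi -> 0 < 2 - 2 * cos y.
Proof.
move=> /andP[y0 ypi]; have := cos_lt_cos (lexx 0) y0 ypi; rewrite cos0; lra.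
Qed.

Lemma chordE y : 2 - 2 * cos y = 4 * sin (y / 2) ^+ 2.
Proof.
have -> : cos y = cos (y / 2 *+ 2) by congr cos; field.
by rewrite cos_mulr2n cos2sin2; ring.
Qed.

End trigonometric_bounds.

(** * The mean squared chord as a function of the offset *)

Section mean_chord.
Set Implicit Arguments.
Unset Strict Implicit.
Context (R : realType) (n : nat) (c : R -> 'rV[R]_n).
Local Notation mu := (@lebesgue_measure R).
Local Notation T := (@pi R *+ 2).
Hypothesis cc : closed_unit_speed c.

Lemma period_gt0 : 0 < T. Proof. by rewrite pmulrn_lgt0// pi_gt0. Qed.

Lemma lebesgue_measure_period : mu `[0, T[%classic = T%:E.
Proof. by rewrite lebesgue_measure_itv/= lte_fin period_gt0 EFinN oppe0 adde0. Qed.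

(** The total over a period, not divided by its length: the unit circle has the value
    [T * (2 - 2 * cos y)]. *)
Definition mean_chord (y : R) : R :=
  \int[mu]_(s in `[0, T[) (enorm (c (s + y) - c s) ^+ 2).

Lemma unit_speed_coord_continuous (i : 'I_n) : continuous (fun t => c t ord0 i).
Proof.
move=> x; apply/cvgrPdist_le => /= e e0; near=> y.
apply: (@le_trans _ _ `|x - y|); last by near: y; exact: cvgr_dist_le.
apply: le_trans (unit_speed_lipschitz cc x y).
rewrite -ler_sqr ?nnegrE ?enorm_ge0// sqr_enorm real_normK ?num_real// /dotmul (bigD1 i)//= !mxE -expr2.
by rewrite lerDl sumr_ge0// => j _; rewrite -expr2 sqr_ge0.
Unshelve. all: by end_near.
Qed.

Lemma measurable_chord d (X : measurableType d) (D : set X)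
    (u v : X -> measurableTypeR R) :
  measurable_fun D u -> measurable_fun D v ->
  measurable_fun D (fun x => enorm (c (u x) - c (v x)) ^+ 2 : measurableTypeR R).
Proof.
move=> mu_ mv; under eq_fun do rewrite sqr_enorm.
apply: measurable_sum => i.
have mc := continuous_measurable_fun (@unit_speed_coord_continuous i).
have m1 : measurable_fun D (fun x => (c (u x) - c (v x)) ord0 i).
  under eq_fun do rewrite !mxE.
  apply: measurable_funB; exact: measurableT_comp mc _.
exact: measurable_funM.
Qed.

Lemma bounded_integrable_period (f : R -> R) (M : R) :
  measurable_fun `[0, T[ f -> (forall x, `|f x| <= M) ->
  mu.-integrable `[0, T[ (EFin \o f).
Proof.
move=> mf fM; apply: measurable_bounded_integrable => //.
  by have := ltry T; rewrite -lebesgue_measure_period; exact.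
exists M; split; first by rewrite num_real.
by move=> N MN x _ /=; apply: le_trans (ltW MN).
Qed.

Lemma integrable_chord (y z : R) : mu.-integrable `[0, T[
  (EFin \o (fun s => enorm (c (s + y) - c (s + z)) ^+ 2)).
Proof.
apply: (@bounded_integrable_period _ (pi ^+ 2)).
  by apply: measurable_chord; exact: measurable_funD.
move=> s; rewrite normrX ger0_norm ?enorm_ge0// ler_sqr ?nnegrE ?enorm_ge0 ?pi_ge0//.
exact: le_trans (enorm_le_circle_dist cc _ _) (circle_dist_le_pi _ _).
Qed.

Lemma mean_chord_shift (y z : R) :
  \int[mu]_(s in `[0, T[) (enorm (c (s + y) - c (s + z)) ^+ 2) = mean_chord (y - z).
Proof.
rewrite /mean_chord /Rintegral; congr fine.
rewrite -(@ge0_integral_period _ z (fun s => (enorm (c (s + (y - z)) - c s) ^+ 2)%:E)).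
- by apply: eq_integral => s _; rewrite addrA addrAC addrK.
- by move=> s; rewrite addrAC !(closed_unit_speed_periodic cc).
- apply/measurable_EFinP; apply: measurable_chord => //; exact: measurable_funD.
- by move=> s; rewrite lee_fin sqr_ge0.
Qed.

Lemma mean_chordN (y : R) : mean_chord (- y) = mean_chord y.
Proof.
rewrite -(sub0r y) -mean_chord_shift /mean_chord; congr fine.
by apply: eq_integral => s _; rewrite addr0 enormB.
Qed.

Lemma mean_chord_periodic (y : R) : mean_chord (y + T) = mean_chord y.
Proof.
rewrite /mean_chord; congr fine.
by apply: eq_integral => s _; rewrite addrA (closed_unit_speed_periodic cc).
Qed.

Lemma mean_chord_le_sqr (y : R) : mean_chord y <= T * y ^+ 2.
Proof.
apply: (@le_trans _ _ (\int[mu]_(s in `[0, T[) y ^+ 2)).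
  apply: le_Rintegral => //.
  - have := @integrable_chord y 0.
    by apply: eq_integrable => // s _ /=; rewrite addr0.
  - by apply: (@bounded_integrable_period _ `|y ^+ 2|).
  - move=> s _; rewrite -(real_normK (num_real y)) ler_sqr ?nnegrE ?enorm_ge0//.
    by have := unit_speed_lipschitz cc (s + y) s; rewrite addrAC subrr add0r.
by rewrite Rintegral_cst// [fine _](congr1 fine lebesgue_measure_period) mulrC.
Qed.

Let sqr_le_sqr_add (a b e p : R) : 0 <= a -> 0 <= b -> 0 <= e ->
  a <= e + b -> a <= p -> b <= p -> a ^+ 2 <= 2 * p * e + b ^+ 2.
Proof.
move=> a0 b0 e0 abe ap bp; have p0 : 0 <= p by lra.
have [ab|ba] := leP a b.
  have := mulr_ge0 p0 e0.
  have : a ^+ 2 <= b ^+ 2 by rewrite ler_sqr ?nnegrE.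
  lra.
have : (a - b) * (a + b) <= e * (2 * p) by apply: ler_pM; lra.
lra.
Qed.

(** Chords are at most [pi] and change by at most [|y - z|], so their squares change by at most
    [2 * pi * |y - z|]; integration over the period contributes [T]. *)
Lemma mean_chord_lipschitz (y z : R) :
  `|mean_chord y - mean_chord z| <= T * (2 * pi) * `|y - z|.
Proof.
wlog yz : y z / mean_chord z <= mean_chord y => [hw|].
  by have [/hw|/ltW/hw] := leP (mean_chord z) (mean_chord y); rewrite // distrC (distrC y).
rewrite ger0_norm ?subr_ge0// lerBlDr.
have iz : mu.-integrable `[0, T[ (EFin \o (fun s => enorm (c (s + z) - c s) ^+ 2)).
  by apply: eq_integrable (integrable_chord z 0) => // s _ /=; rewrite addr0.
have ik : mu.-integrable `[0, T[ (EFin \o cst (2 * pi * `|y - z|)).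
  exact: (@bounded_integrable_period _ `|2 * pi * `|y - z| |).
apply: (@le_trans _ _ (\int[mu]_(s in `[0, T[)
    (cst (2 * pi * `|y - z|) s + enorm (c (s + z) - c s) ^+ 2))).
  apply: le_Rintegral => //.
  - by apply: eq_integrable (integrable_chord y 0) => // s _ /=; rewrite addr0.
  - exact: integrable_EFinD.
  move=> s _ /=.
  have d1 := enorm_dist_triangle (c (s + y)) (c (s + z)) (c s).
  have d2 : enorm (c (s + y) - c (s + z)) <= `|y - z|.
    by have := unit_speed_lipschitz cc (s + y) (s + z); rewrite [s + y]addrC addrKA.
  have dpi t u : enorm (c t - c u) <= pi.
    exact: le_trans (enorm_le_circle_dist cc _ _) (circle_dist_le_pi _ _).
  by apply: sqr_le_sqr_add; rewrite ?enorm_ge0//; apply: le_trans d1 _; rewrite lerD2r.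
rewrite RintegralD// lerD2r Rintegral_cst// [fine _](congr1 fine lebesgue_measure_period).
by rewrite /= le_eqVlt; apply/orP; left; apply/eqP; ring.
Qed.

Lemma mean_chord_continuous : continuous mean_chord.
Proof.
have K0 : 0 < T * (2 * pi) by rewrite mulr_gt0 ?period_gt0// mulr_gt0 ?pi_gt0.
move=> x; apply/cvgrPdist_le => /= e e0; have eK := divr_gt0 e0 K0; near=> y.
apply: le_trans (mean_chord_lipschitz x y) _.
rewrite mulrC -ler_pdivlMr; last by [].
near: y; exact: cvgr_dist_le.
Unshelve. all: by end_near.
Qed.

(** Such an integral is a function of the mean chords alone. A curve with the mean chords of the
    unit circle therefore has the same value as the unit circle, which is how the equality case is
    treated. *)
Lemma mean_chord_four_points (a0 a1 a2 a3 y0 y1 y2 y3 : R) :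
  a0 + a1 + a2 + a3 = 0 ->
  \int[mu]_(s in `[0, T[) (enorm (a0 *: c (s + y0) + a1 *: c (s + y1) +
      a2 *: c (s + y2) + a3 *: c (s + y3)) ^+ 2) =
  - (a0 * a1 * mean_chord (y0 - y1) + a0 * a2 * mean_chord (y0 - y2)
   + a0 * a3 * mean_chord (y0 - y3) + a1 * a2 * mean_chord (y1 - y2)
   + a1 * a3 * mean_chord (y1 - y3) + a2 * a3 * mean_chord (y2 - y3)).
Proof.
move=> a_sum; under eq_Rintegral do rewrite dotmul_four_points//.
have iZ (k y z : R) : mu.-integrable `[0, T[
    (EFin \o (fun s => k * enorm (c (s + y) - c (s + z)) ^+ 2)).
  by apply: integrable_EFinZ => //; exact: integrable_chord.
under eq_Rintegral do rewrite -mulN1r.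
rewrite RintegralZl//; last by do !apply: integrable_EFinD.
rewrite mulN1r !RintegralD//; do ?apply: integrable_EFinD => //.
rewrite !RintegralZl ?mean_chord_shift//; exact: integrable_chord.
Qed.

End mean_chord.

(** * From almost everywhere to everywhere by continuity *)

Section almost_everywhere_density.
Set Implicit Arguments.
Unset Strict Implicit.
Context (R : realType).
Local Notation mu := (@lebesgue_measure R).

Lemma ae_exists_itv (P : R -> Prop) (a b : R) : a < b ->
  {ae mu, forall x, P x} -> exists2 x, a < x < b & P x.
Proof.
move=> ab [N [mN N0 PN]]; apply: contrapT => nP.
have abN : `]a, b[%classic `<=` N.
  move=> x /=; rewrite in_itv/= => abx; apply: PN => /= Px.
  by apply: nP; exists x.
have : (mu `]a, b[%classic <= mu N)%E.
  by apply: le_measure; rewrite ?inE//; exact: measurable_itv.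
by rewrite N0 lebesgue_measure_itv/= lte_fin ab -EFinD lee_fin subr_le0 leNgt ab.
Qed.

(** A point where the functions differ would come with an interval of such points, which is not
    null. *)
Lemma ae_eq_continuous (f g : R -> R) (a b x : R) : continuous f -> continuous g ->
  {ae mu, forall y, a < y < b -> f y = g y} -> a < x < b -> f x = g x.
Proof.
move=> cf cg fg /andP[ax xb]; apply/eqP; rewrite -subr_eq0; apply/negPn/negP => fgx.
have ch : {for x, continuous (fun y => f y - g y)} by apply: cvgB; [exact: cf|exact: cg].
have [e /= e0 near_x] : \forall y \near x, f y - g y != 0.
  by apply: (cvgr_neq0 _ ch fgx).
pose lo := Num.max a (x - e); pose hi := Num.min b (x + e).
have lohi : lo < hi.
  by rewrite /lo /hi gt_max !lt_min; apply/andP; split; apply/andP; split; lra.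
have [y /andP[]] := ae_exists_itv lohi fg.
rewrite gt_max lt_min => /andP[ay xey] /andP[yb yxe] fgy.
have : f y - g y != 0 by apply: near_x; rewrite /= ltr_norml; lra.
by rewrite fgy ?subrr ?eqxx// ay.
Qed.

Lemma Rintegral_eq0_continuous (f : R -> R) (a b x : R) : continuous f ->
  (forall y, 0 <= f y) -> mu.-integrable `[a, b[ (EFin \o f) ->
  \int[mu]_(y in `[a, b[) f y = 0 -> a < x < b -> f x = 0.
Proof.
move=> cf f0 fi intf0 abx.
apply: (@ae_eq_continuous f (cst 0) a b) => //; first exact: cst_continuous.
have mI : measurable (`[a, b[%classic : set (measurableTypeR R)) by exact: measurable_itv.
have fin : (\int[mu]_(y in `[a, b[) (f y)%:E)%E \is a fin_num by exact: integrable_fin_num.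
have : (\int[mu]_(y in `[a, b[) `|(f y)%:E| = 0)%E.
  under eq_integral do rewrite gee0_abs ?lee_fin ?f0//.
  by rewrite -(fineK fin); congr EFin.
move=> /(ae_eq_integral_abs mu mI (measurable_int _ fi)).1.
apply: filterS => y /= fy /andP[ay yb].
by have /fy[] : `[a, b[%classic y by rewrite /= in_itv/= ltW.
Qed.

End almost_everywhere_density.

(** * The inequality for mean squared chords *)

Lemma exists_small_step (R : realFieldType) (M y b : R) : 0 < M -> 0 < y < b ->
  exists e, [/\ 0 < e, e <= 1, e <= M / 16, 0 < y + e < b & 0 < y - e < b].
Proof.
move=> M0 /andP[y0 yb].
pose e := Num.min (Num.min 1 (M / 16)) (Num.min (y / 2) ((b - y) / 2)).
have e0 : 0 < e by rewrite !lt_min -andbA; apply/and4P; split; lra.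
have eM : e <= M / 16 by rewrite !ge_min lexx !orbT.
have ey : e <= y / 2 by rewrite !ge_min lexx !orbT.
have eb : e <= (b - y) / 2 by rewrite !ge_min lexx !orbT.
by exists e; rewrite [e <= 1]ge_min ge_min lexx eM; split => //; lra.
Qed.

(** Bounding [dp] and [dq] below and dividing by [2 * (p * q)] leaves [M * se ^+ 2 <= - de]. The
    left side is at least [M * e ^+ 2 / 8]; the right side is at most [13 / 24 * e ^+ 4], and
    [e ^+ 2 <= M / 16] makes this at most [13 / 384 * M * e ^+ 2], which is smaller. *)
Lemma trapezoid_negative_min (R : realFieldType) (M e p q r se dp dq de : R) :
  0 < M -> 0 < e -> e <= 1 -> e <= M / 16 ->
  - (e ^+ 4 * (13 / 24)) <= de -> e ^+ 2 / 8 <= se ^+ 2 -> 0 < q -> 0 < p ->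
  - M * q ^+ 2 <= dq -> - M * p ^+ 2 <= dp -> p * q = r ^+ 2 - se ^+ 2 ->
  ~ (q ^+ 2 * dp + p ^+ 2 * dq <= 2 * (p * q) * (- M * r ^+ 2 - de)).
Proof.
move=> M0 e0 e1 eM hde hse q0 p0 hdq hdp pq.
set P := p * q => trap.
have P0 : 0 < P by rewrite mulr_gt0.
have h1 : q ^+ 2 * (- M * p ^+ 2) <= q ^+ 2 * dp by rewrite ler_wpM2l ?sqr_ge0.
have h2 : p ^+ 2 * (- M * q ^+ 2) <= p ^+ 2 * dq by rewrite ler_wpM2l ?sqr_ge0.
have : 2 * P * (- M * P) <= 2 * P * (- M * r ^+ 2 - de).
  by apply: le_trans trap; rewrite (_ : 2 * P * (- M * P) =
    q ^+ 2 * (- M * p ^+ 2) + p ^+ 2 * (- M * q ^+ 2)); [lra|rewrite /P; ring].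
rewrite ler_pM2l ?mulr_gt0// /P pq => h3.
have e2 : 0 < e ^+ 2 by rewrite exprn_gt0.
have h4 : e * e <= 1 * (M / 16) by apply: ler_pM => //; lra.
have h5 : e ^+ 2 * (e * e) <= e ^+ 2 * (M / 16) by rewrite ler_wpM2l ?sqr_ge0//; lra.
have h6 := ler_wpM2l (ltW M0) hse.
have h7 := mulr_gt0 M0 e2.
lra.
Qed.

Section mean_chord_inequality.
Set Implicit Arguments.
Unset Strict Implicit.
Context (R : realType) (n : nat) (c : R -> 'rV[R]_n).
Local Notation T := (@pi R *+ 2).
Hypothesis cc : closed_unit_speed c.

Let chord (y : R) : R := 2 - 2 * cos y.
Let deficit (y : R) : R := T * chord y - mean_chord c y.
Let s (y : R) : R := sin (y / 2).

Let chord_s y : chord y = 4 * s y ^+ 2. Proof. exact: chordE. Qed.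

Let s_gt0 y : 0 < y < T -> 0 < s y.
Proof. by move=> yT; apply: sin_gt0_pi; lra. Qed.

Let s_mul y e : s (y + e) * s (y - e) = s y ^+ 2 - s e ^+ 2.
Proof.
rewrite /s mulrDl mulrBl sinD sinB.
transitivity (sin (y / 2) ^+ 2 * cos (e / 2) ^+ 2 - cos (y / 2) ^+ 2 * sin (e / 2) ^+ 2).
  by ring.
by rewrite !cos2sin2; ring.
Qed.

Let deficitN y : deficit (- y) = deficit y.
Proof. by rewrite /deficit /chord cosN mean_chordN. Qed.

Let deficit_periodic y : deficit (y + T) = deficit y.
Proof. by rewrite /deficit /chord cosD2pi mean_chord_periodic. Qed.

Let deficit_continuous : continuous deficit.
Proof.
move=> y; apply: cvgB; last exact: mean_chord_continuous.
apply: cvgM; first exact: cvg_cst.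
apply: cvgB; first exact: cvg_cst.
apply: cvgM; [exact: cvg_cst|exact: continuous_cos].
Qed.

Let s_continuous : continuous s.
Proof.
move=> y; apply: cvg_comp; last exact: continuous_sin.
by apply: cvgM; [exact: cvg_id|exact: cvg_cst].
Qed.

Let T_lt : T < 13 / 2. Proof. by have := pi_lt_16_5 R; lra. Qed.

(** The constant is the bound [13 / 2] for [T] times the [1 / 12] of the quartic bound for the
    cosine. *)
Let deficit_ge y : 0 <= y -> - (y ^+ 4 * (13 / 24)) <= deficit y.
Proof.
move=> y0; have := mean_chord_le_sqr cc y; have := sqr_sub_chord_le y0.
have := period_gt0 R; have := T_lt.
rewrite /deficit /chord; move: T (mean_chord _ _) => p A p1 p0 h1 h2.
have : p * (y ^+ 2 - (2 - 2 * cos y)) <= p * (y ^+ 4 / 12) by rewrite ler_pM2l.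
have : p * (y ^+ 4) <= (13 / 2) * y ^+ 4 by apply: ler_wpM2r; [exact: exprn_ge0|exact: ltW].
lra.
Qed.

Let s_ge y : 0 <= y <= 1 -> y ^+ 2 / 8 <= s y ^+ 2.
Proof.
move=> /andP[y0 y1]; have := chord_s y; rewrite /chord.
have := sqr_sub_chord_le y0; have := sqr_ge0 y.
have : y ^+ 4 <= y ^+ 2 by rewrite (exprD _ 2 2) ler_piMr ?sqr_ge0// expr_le1.
lra.
Qed.

(* The trapezoid with vertices c(t), c(t+e), c(t+y), c(t+y+e): the integrand is
   |s(y-e) (c(t+y+e) - c(t)) - s(y+e) (c(t+y) - c(t+e))|^2, which vanishes for the
   unit circle. *)
Let trapezoid y e : s (y - e) ^+ 2 * deficit (y + e) + s (y + e) ^+ 2 * deficit (y - e) <=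
  2 * (s (y + e) * s (y - e)) * (deficit y - deficit e).
Proof.
have := @mean_chord_four_points _ _ _ cc (- s (y - e)) (s (y + e)) (- s (y + e)) (s (y - e))
  0 e y (y + e).
have -> : - s (y - e) + s (y + e) - s (y + e) + s (y - e) = 0 by ring.
move=> /(_ erefl) four.
have : 0 <= \int[@lebesgue_measure R]_(t in `[0, T[)
    (enorm (- s (y - e) *: c (t + 0) + s (y + e) *: c (t + e) +
     - s (y + e) *: c (t + y) + s (y - e) *: c (t + (y + e))) ^+ 2).
  by apply: Rintegral_ge0 => t _; rewrite sqr_ge0.
rewrite {}four !sub0r !(mean_chordN cc).
rewrite (_ : e - (y + e) = - y); last by ring.
rewrite (_ : y - (y + e) = - e); last by ring.
rewrite -(opprB y e) !(mean_chordN cc).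
(* For the unit circle the trapezoid relation is an equality. Combined with [T] times this equality,
   the relation between mean chords becomes one between deficits. *)
have : s (y - e) ^+ 2 * chord (y + e) + s (y + e) ^+ 2 * chord (y - e) =
    2 * (s (y + e) * s (y - e)) * (chord y - chord e).
  rewrite !chord_s (_ : 4 * s y ^+ 2 - 4 * s e ^+ 2 = 4 * (s y ^+ 2 - s e ^+ 2)); last by ring.
  by rewrite -s_mul; ring.
move=> /(congr1 (fun z => T * z)); rewrite /deficit.
move: (s (y - e)) (s (y + e)) => a b.
move: (chord (y + e)) (chord (y - e)) (chord y) (chord e) => p q r t.
move: (mean_chord _ _) (mean_chord _ _) (mean_chord _ _) (mean_chord _ _) => i j k l.
move: T => m; lra.
Qed.

Lemma mean_chord_le y : mean_chord c y <= T * (2 - 2 * cos y).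
Proof.
rewrite -subr_ge0 -/(deficit y) leNgt; apply/negP => def_neg.
have T0 := period_gt0 R.
have [k /andP[k0 kT]] := period_representative y.
have {def_neg k0 kT} [y1 [/andP[y10 y1T] def_neg]] : exists y1, 0 < y1 < T /\ deficit y1 < 0.
  exists (y + T *~ k); rewrite (periodicMz k deficit_periodic); split => //.
  rewrite kT andbT lt_def k0 andbT; apply/negP => /eqP yk0.
  move: def_neg; rewrite -(periodicMz k deficit_periodic y) yk0.
  have := deficit_ge (lexx 0); rewrite expr0n/= mul0r oppr0 => h.
  by rewrite ltNge h.
have s1 := s_gt0 (introT andP (conj y10 y1T)).
pose m := - deficit y1 / s y1 ^+ 2.
have m0 : 0 < m by rewrite divr_gt0 ?oppr_gt0 ?exprn_gt0.
have def1 : deficit y1 = - m * s y1 ^+ 2.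
  by rewrite /m mulNr divfK ?opprK// lt0r_neq0// exprn_gt0.
(* Near 0, and by reflection near [T], the deficit stays above the level [- m * s z ^+ 2] that is
   attained at [y1]. The minimum over the compact interval [[d, T - d]] is thus a minimum over the
   open period. *)
have near0 z d : 0 < z <= d -> d <= 1 -> d <= m / 5 -> - m * s z ^+ 2 < deficit z.
  move=> /andP[z0 zd] d1 dm; apply: lt_le_trans (deficit_ge (ltW z0)).
  have := s_ge (introT andP (conj (ltW z0) (le_trans zd d1))).
  have zm : z * z <= 1 * (m / 5) by apply: ler_pM => //; lra.
  have : z ^+ 2 * (z * z) <= z ^+ 2 * (m / 5) by rewrite ler_wpM2l ?sqr_ge0//; lra.
  have z2 : 0 < z ^+ 2 by rewrite exprn_gt0.
  have := mulr_gt0 m0 z2.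
  move=> h1 h2 /(ler_wpM2l (ltW m0)) h3.
  by rewrite -subr_gt0; lra.
(* [m / 5] works because [13 / 24 * (1 / 5) = 13 / 120 < 1 / 8]; [T / 4] leaves room for
   [[d, T - d]]. *)
pose d := Num.min 1 (Num.min (m / 5) (T / 4)).
have d0 : 0 < d by rewrite !lt_min; apply/and3P; split; lra.
have d1 : d <= 1 by rewrite ge_min lexx.
have dm : d <= m / 5 by rewrite !ge_min lexx orbT.
have dT : d <= T / 4 by rewrite !ge_min lexx !orbT.
have near_end z : 0 < z < T -> (z <= d) || (T - d <= z) -> - m * s z ^+ 2 < deficit z.
  move=> /andP[z0 zT] /orP[zd|dz]; first by apply: (near0 _ d) => //; apply/andP.
  have -> : deficit z = deficit (T - z) by rewrite addrC deficit_periodic deficitN.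
  have -> : s z = s (T - z).
    rewrite /s (_ : (T - z) / 2 = - (z / 2) + pi); last by field.
    by rewrite sinDpi sinN opprK.
  by apply: (near0 _ d) => //; apply/andP; split; lra.
have y1_mid : d <= y1 <= T - d.
  rewrite !leNgt; apply/andP; split; apply/negP => y1d.
    by have := near_end y1; rewrite y10 y1T (ltW y1d) def1 ltxx => /(_ isT isT).
  by have := near_end y1; rewrite y10 y1T (ltW y1d) orbT def1 ltxx => /(_ isT isT).
have in_period z : d <= z <= T - d -> 0 < z < T by move=> /andP[]; lra.
have cE : {within `[d, T - d], continuous (fun z => deficit z / s z ^+ 2)}.
  apply: continuous_in_subspaceT => z; rewrite inE/= in_itv/= => /in_period zT.
  apply: cvgM; first exact: deficit_continuous.
  apply: cvgV; first by rewrite lt0r_neq0// exprn_gt0// s_gt0.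
  exact: cvgM (@s_continuous z) (@s_continuous z).
have dTd : d <= T - d by lra.
(* A negative minimum of deficit / s^2 at y0 contradicts the trapezoid inequality at y0
   for small e: there the deficit at e is O(e^4), while s(e)^2 >= e^2 / 8. *)
have [y0] := EVT_min dTd cE; rewrite in_itv/= => y0_mid min_y0.
have y0T := in_period _ y0_mid.
have s0 := s_gt0 y0T.
pose M := - (deficit y0 / s y0 ^+ 2).
have def0 : deficit y0 = - M * s y0 ^+ 2.
  by rewrite /M opprK divfK// lt0r_neq0// exprn_gt0.
have mM : m <= M.
  have := min_y0 y1; rewrite in_itv/= => /(_ y1_mid).
  by rewrite /M /m mulNr lerN2.
have def_ge z : 0 < z < T -> - M * s z ^+ 2 <= deficit z.
  move=> zT; have sz : 0 < s z ^+ 2 by rewrite exprn_gt0// s_gt0.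
  have [z_end|] := boolP ((z <= d) || (T - d <= z)).
    apply: le_trans (ltW (near_end z zT z_end)).
    by rewrite ler_pM2r// lerN2.
  rewrite negb_or -!ltNge => /andP[dz zd].
  rewrite -ler_pdivlMr// /M opprK; apply: min_y0.
  by rewrite in_itv/= !ltW.
have M0 := lt_le_trans m0 mM.
have [e [e0 e1 eM yp ym]] := exists_small_step M0 y0T.
have := trapezoid y0 e; have := s_mul y0 e.
have := def_ge _ yp; have := def_ge _ ym.
have := s_gt0 yp; have := s_gt0 ym.
have := s_ge (introT andP (conj (ltW e0) e1)); have := deficit_ge (ltW e0).
rewrite def0; move: (s (y0 + e)) (s (y0 - e)) (s y0) (s e) => p q r se.
move: (deficit (y0 + e)) (deficit (y0 - e)) (deficit e) => dp dq de.
by move=> hde hse q0 p0 hdq hdp pq /(trapezoid_negative_min M0 e0 e1 eM hde hse q0 p0 hdq hdp pq).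
Qed.

End mean_chord_inequality.

(** * The equality case: only round circles have the mean chords of the circle *)

Section rigidity.
Set Implicit Arguments.
Unset Strict Implicit.
Context (R : realType) (n : nat) (c : R -> 'rV[R]_n).
Local Notation T := (@pi R *+ 2).
Hypothesis cc : closed_unit_speed c.

Lemma unit_speed_scale_shift_continuous (a y : R) (i : 'I_n) :
  continuous (fun s => a * c (s + y) ord0 i).
Proof.
move=> s; apply: cvgM; first exact: cvg_cst.
apply: (@cvg_comp _ _ _ (fun s => s + y) (fun t => c t ord0 i)); last first.
  exact: unit_speed_coord_continuous.
by apply: cvgD; [exact: cvg_id|exact: cvg_cst].
Qed.

(** On the unit circle the point at [t] is an affine combination of the points at [0], [pi] and
    [pi / 2], with weights [l0], [l1] and [sin t]. The integrated squared error of this relation,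
    translated along the curve, depends on mean chords only, so it vanishes for [c] too, and by
    continuity so does the integrand. *)
Lemma unit_speed_on_circle :
  (forall y, mean_chord c y = T * (2 - 2 * cos y)) ->
  forall t, c t = 2^-1 *: (c 0 + c pi) + cos t *: (2^-1 *: (c 0 - c pi)) +
    sin t *: (c (pi / 2) - 2^-1 *: (c 0 + c pi)).
Proof.
move=> eqA t.
have pi0 := pi_gt0 R.
pose l0 := (1 - sin t + cos t) / 2; pose l1 := (1 - sin t - cos t) / 2.
(* The nodes are shifted by [- pi] so that the wanted relation is the one at [s = pi], an interior
   point of the period. *)
pose f s := enorm (1 *: c (s + (t - pi)) + - l0 *: c (s + - pi) + - l1 *: c (s + 0) +
  - sin t *: c (s + - (pi / 2))) ^+ 2.
pose g i s := 1 * c (s + (t - pi)) ord0 i + - l0 * c (s + - pi) ord0 i +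
  - l1 * c (s + 0) ord0 i + - sin t * c (s + - (pi / 2)) ord0 i.
have cf : continuous f.
  have -> : f = fun s => \sum_(i < n) g i s * g i s.
    by apply/funext => s; rewrite /f sqr_enorm; apply: eq_bigr => i _; rewrite !mxE.
  move=> s; apply: (@cvg_big R^o _ _ _ _ (@add_continuous R^o) _ (nbhs s)) => i _.
  have cg : continuous (g i).
    by move=> x; do !apply: cvgD; exact: unit_speed_scale_shift_continuous.
  by apply: cvgM; exact: cg.
have four := @mean_chord_four_points _ _ _ cc 1 (- l0) (- l1) (- sin t)
  (t - pi) (- pi) 0 (- (pi / 2)).
have f_int0 : \int[@lebesgue_measure R]_(s in `[0, T[) f s = 0.
  rewrite /f four; last by rewrite /l0 /l1; field.
  rewrite !eqA.
  rewrite (_ : t - pi - - pi = t); last by ring.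
  rewrite (_ : t - pi - 0 = t - pi); last by ring.
  rewrite (_ : t - pi - - (pi / 2) = t - pi / 2); last by field.
  rewrite (_ : - pi - 0 = - pi); last by ring.
  rewrite (_ : - pi - - (pi / 2) = - (pi / 2)); last by field.
  rewrite (_ : 0 - - (pi / 2) = pi / 2); last by ring.
  rewrite !cosN cosBpihalf cospi cos_pihalf cosB cospi sinpi.
  have := cos2Dsin2 t; rewrite /l0 /l1.
  move: (cos t) (sin t) T => a b m h.
  rewrite (_ : - _ = m * (1 - (a ^+ 2 + b ^+ 2))); last by field.
  by rewrite h subrr mulr0.
have f0 s : 0 <= f s by rewrite sqr_ge0.
have fi : (@lebesgue_measure R).-integrable `[0, T[ (EFin \o f).
  have fi' : (@lebesgue_measure R).-integrable `[0, T]%classic (EFin \o f).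
    apply: continuous_compact_integrable; first exact: segment_compact.
    exact: continuous_subspaceT.
  apply: integrableS fi'; try exact: measurable_itv.
  by move=> x; rewrite /= !in_itv/= => /andP[-> /ltW].
have := Rintegral_eq0_continuous cf f0 fi f_int0 (x := pi).
have piT : 0 < (pi : R) < T by rewrite pi0 mulr2n ltrDl.
move=> /(_ piT) /eqP; rewrite sqrf_eq0 => /eqP/enorm_eq0.
rewrite (_ : pi + (t - pi) = t); last by ring.
rewrite subrr addr0 scale1r.
rewrite (_ : pi - pi / 2 = pi / 2); last by field.
rewrite !scaleNr => /eqP; rewrite !subr_eq0 => /eqP h.
apply/rowP => i; have := congr1 (fun v : 'rV[R]_n => v ord0 i) h.
rewrite !mxE /l0 /l1 => e.
have -> : c t ord0 i = c t ord0 i - l0 * c 0 ord0 i - l1 * c pi ord0 i + l0 * c 0 ord0 i + l1 * c pi ord0 i.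
  by ring.
by rewrite e /l0 /l1; field.
Qed.

(** The speed identity holds almost everywhere, hence everywhere by continuity. At [0] and [pi / 2]
    it normalizes [v] and [u]; comparing [pi / 4] with [- (pi / 4)] gives orthogonality. *)
Lemma unit_speed_round :
  (forall y, mean_chord c y = T * (2 - 2 * cos y)) -> round_circle1 c.
Proof.
move=> /unit_speed_on_circle.
set p := 2^-1 *: (c 0 + c pi); set u := 2^-1 *: (c 0 - c pi); set v := c (pi / 2) - p.
move=> cE; clearbody v u p.
have c'E t : derivable c t 1 /\ derive1 c t = - sin t *: u + cos t *: v.
  have dE i j : is_derive t 1 (fun t => c t i j) ((- sin t *: u + cos t *: v) i j).
    rewrite (ord1 i).
    rewrite (_ : (fun t => c t ord0 j) =
      (fun t => p ord0 j + cos t * u ord0 j + sin t * v ord0 j)); last first.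
      by apply/funext => x; rewrite cE !mxE.
    by apply: is_derive_eq; rewrite !mxE/= ?scaler0 /GRing.scale/=; ring.
  have dc : derivable c t 1.
    by apply/derivable_mxP => i j; exact: ex_derive.
  split => //; rewrite derive1E (derive_mx dc); apply/matrixP => i j.
  by rewrite mxE derive_val.
have speed t : sin t * sin t * dotmul u u + cos t * cos t * dotmul v v
    - 2 * (sin t * cos t * dotmul u v) = 1.
  case: cc => _ _ speed.
  have cs : continuous (@sin R) by exact: continuous_sin.
  have cco : continuous (@cos R) by exact: continuous_cos.
  apply: (@ae_eq_continuous R (fun t => sin t * sin t * dotmul u u + cos t * cos t * dotmul v v
    - 2 * (sin t * cos t * dotmul u v)) (cst 1) (t - 1) (t + 1)).
  - move=> x; have sx := cs x; have cx := cco x.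
    apply: cvgB; first apply: cvgD.
    + exact: cvgM (cvgM sx sx) (cvg_cst _).
    + exact: cvgM (cvgM cx cx) (cvg_cst _).
    + exact: cvgM (cvg_cst _) (cvgM (cvgM sx cx) (cvg_cst _)).
  - exact: cst_continuous.
  - move: speed => [N [mN N0 speedN]]; exists N; split => //.
    apply: subset_trans speedN; apply: subsetC => x [_]; have [_ ->] := c'E x => + _.
    move=> /(congr1 (fun z => z ^+ 2)); rewrite sqr_enorm expr1n => h; rewrite /= -[RHS]h.
    rewrite !(dotmulDl, dotmulDr, dotmulZl, dotmulZr) (dotmulC v u) /=.
    move: (sin x) (cos x) (dotmul u u) (dotmul u v) (dotmul v v) => a b d e f; ring.
  - by apply/andP; split; lra.
have vv : dotmul v v = 1 by have := speed 0; rewrite sin0 cos0; lra.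
have uu : dotmul u u = 1 by have := speed (pi / 2); rewrite sin_pihalf cos_pihalf; lra.
exists p, u, v; split => //.
- by rewrite /enorm uu sqrtr1.
- by rewrite /enorm vv sqrtr1.
have := speed (pi / 4); have := speed (- (pi / 4)); rewrite sinN cosN uu vv => h1 h2.
have : sin (pi / 4) * cos (pi / 4) * dotmul u v = 0 by lra.
move=> /eqP; rewrite !mulf_eq0 -orbA => /or3P[/eqP s0|/eqP c0|/eqP//].
  by have : 0 < sin (pi / 4 : R); [apply: sin_gt0_pi; have := pi_gt0 R; lra|rewrite s0 ltxx].
have : 0 < cos (pi / 4 : R); last by rewrite c0 ltxx.
by apply: cos_gt0_pihalf; have := pi_gt0 R; lra.
Qed.

End rigidity.

(** * Self-intersections form a null set *)

Section self_intersections.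
Set Implicit Arguments.
Unset Strict Implicit.
Context (R : realType) (n : nat) (c : R -> 'rV[R]_n).
Local Notation mu := (@lebesgue_measure R).
Hypothesis cc : closed_unit_speed c.

Lemma negligible_subsingleton (A : set R) :
  (forall s t, A s -> A t -> s = t) -> mu.-negligible A.
Proof.
move=> A1; have [[t At]|A0] := pselect (exists t, A t).
  exists [set t]; split; [exact: measurable_set1|exact: lebesgue_measure_set1|].
  by move=> s As; exact: A1.
exists set0; split => //.
by move=> t At; apply: A0; exists t.
Qed.

(* A point of a level set where |c'| = 1 is isolated in it. *)
Lemma level_set_negligible (v : 'rV[R]_n) : mu.-negligible [set t | c t = v].
Proof.
case: cc => _ _ [N [mN N0 badN]].
(* Isolated points of the level set are singled out by rational intervals, so they form a countable
   union of sets with at most one point. *)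
pose Z (q : rat * rat) := [set t | [/\ ratr q.1 < t < ratr q.2, c t = v &
  forall s, ratr q.1 < s < ratr q.2 -> c s = v -> s = t]].
pose F k := if unpickle k is Some q then Z q else set0.
apply: (@negligibleS _ _ _ mu (N `|` \bigcup_k F k)); last first.
  apply: negligibleU; first by apply/negligibleP.
  apply: negligible_bigcup => k; rewrite /F; case: unpickle => [q|]; last exact: negligible_set0.
  by apply: negligible_subsingleton => s t [sq cs _] [_ _ tq]; exact: tq.
move=> t /= ct; have [Nt|nNt] := pselect (N t); [by left|right].
have [dct ct1] : derivable c t 1 /\ enorm (derive1 c t) = 1.
  by apply: contrapT => /badN.
(* At speed 1 an error of half of [|s - t|] already excludes [c s = c t] for nearby [s] other than
   [t]. *)
have half0 : 0 < 2^-1 :> R by rewrite invr_gt0.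
have [eta eta0 near_t] := derivable_enorm_near dct half0.
have tl : t - eta < t by rewrite ltrBlDr ltrDl.
have tr : t < t + eta by rewrite ltrDl.
have [q1] := rat_in_itvoo tl; rewrite in_itv/= => /andP[q1l q1t].
have [q2] := rat_in_itvoo tr; rewrite in_itv/= => /andP[tq2 q2r].
have FZ q : F (pickle q) = Z q by rewrite /F pickleK.
exists (pickle (q1, q2)); [exact: I|rewrite FZ; split; [by rewrite /= q1t| exact: ct|]].
rewrite /=.
move=> s /andP[q1s sq2] cs; apply/eqP; rewrite -subr_eq0 -normr_eq0; apply/eqP.
have : `|s - t| < eta by rewrite ltr_norml; lra.
move=> /near_t; rewrite cs ct subrr enorm0 ct1 mul1r sub0r normrN normr_id.
by have := normr_ge0 (s - t); lra.
Qed.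

(** The slices of this closed relation are level sets, hence null. It is required because the
    supporting lines bound [F] at positive squared chords only. *)
Lemma self_intersections_null : {ae leb2 R, forall z, c z.1 <> c z.2}.
Proof.
pose S := [set z : R * R | c z.1 = c z.2].
have mS : measurable S.
  have mf : measurable_fun setT (fun z : R * R => enorm (c z.1 - c z.2) ^+ 2).
    by apply: measurable_chord.
  have -> : S = (fun z : R * R => enorm (c z.1 - c z.2) ^+ 2) @^-1` [set 0].
    apply/seteqP; split => z /=; first by rewrite /S/= => ->; rewrite subrr enorm0 expr0n.
    by move=> /eqP; rewrite sqrf_eq0 => /eqP/enorm_eq0/eqP; rewrite subr_eq0 => /eqP.
  by rewrite -[X in measurable X]setTI; apply: mf => //; exact: measurable_set1.
exists S; split => //; last by move=> z /= /contrapT.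
apply: integral0_eq => x _ /=.
have xS : xsection S x = [set t | c t = c x].
  by apply/seteqP; split => t; [move/xsectionP => /= ->|move=> ct; apply/xsectionP].
have ml : measurable [set t | c t = c x].
  by rewrite -xS; exact: measurable_xsection.
rewrite xS; by apply/negligibleP => //; exact: level_set_negligible.
Qed.

End self_intersections.

(** * Integrating functions of the circle distance over the torus *)

Section torus_distance.
Set Implicit Arguments.
Unset Strict Implicit.
Context (R : realType).
Local Open Scope ereal_scope.
Local Notation mu := (@lebesgue_measure R).
Local Notation T := (@pi R *+ 2)%R.

Lemma measurable_circle_dist0 : measurable_fun setT (circle_dist (0 : R)).
Proof. exact: continuous_measurable_fun (@circle_dist_continuous R). Qed.

Lemma measurable_circle_dist :
  measurable_fun setT (fun z : R * R => circle_dist z.1 z.2).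
Proof.
under eq_fun do rewrite circle_dist_shift.
apply: measurableT_comp; first exact: measurable_circle_dist0.
exact: measurable_funB.
Qed.

Lemma integral_circle_dist (f : R -> \bar R) : measurable_fun setT f ->
  (forall y, 0 <= f y) ->
  \int[mu \x mu]_(z in @torus R) f (circle_dist z.1 z.2) =
    \int[mu]_(y in `[0%R, T[) (T%:E * f (circle_dist 0 y)).
Proof.
move=> mf f0; rewrite (@integral_torus_shear _ (fun z => f (circle_dist z.1 z.2))).
- apply: eq_integral => y _ /=.
  under eq_integral do rewrite circle_dist_shift addrAC subrr add0r.
  by rewrite integral_cst//= muleC lebesgue_measure_period.
- by apply: measurableT_comp => //; exact: measurable_circle_dist.
- by [].
- by move=> s t /=; rewrite circle_dist_periodic.
Qed.

Lemma ge0_integral_reflect (A : set R) (f : R -> \bar R) : measurable A ->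
  measurable_fun setT f -> (forall x, 0 <= f x) ->
  \int[mu]_(x in -%R @^-1` A) f (- x)%R = \int[mu]_(x in A) f x.
Proof.
move=> mA mf f0.
have mN : measurable_fun setT (-%R : measurableTypeR R -> measurableTypeR R).
  exact: oppr_measurable.
have := @ge0_integral_pushforward _ _ _ (measurableTypeR R) R
  (-%R : measurableTypeR R -> measurableTypeR R) mN mu A f mA.
move=> <-//; last exact: measurable_funS mf.
apply: eq_measure_integral => B mB _.
exact: lebesgue_measureN.
Qed.

Lemma integral_circle_dist0 (f : R -> \bar R) : measurable_fun setT f ->
  (forall y, 0 <= f y) ->
  \int[mu]_(y in `[0%R, T[) f (circle_dist 0 y) = 2%:E * \int[mu]_(y in `]0%R, pi[) f y.
Proof.
move=> mf f0; have pi0 := pi_gt0 R.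
have mfd : measurable_fun setT (fun y => f (circle_dist 0 y)).
  by apply: measurableT_comp => //; exact: measurable_circle_dist0.
have -> : `[0%R, T[%classic = `[0%R, pi[ `|` `[pi, T[.
  by rewrite -itv_bndbnd_setU// bnd_simp ?ltW// mulr2n ltrDl.
rewrite ge0_integral_setU//=; last 2 first.
- exact: measurable_funS mfd.
- rewrite disj_set2E; apply/eqP/seteqP; split => x//=; rewrite !in_itv/= => -[].
  by move=> /andP[_ xT] /andP[Tx _]; move: xT; rewrite ltNge Tx.
have bd b0 b1 : \int[mu]_(y in [set` Interval (BSide b0 0%R) (BSide b1 pi)]) f y =
    \int[mu]_(y in `]0%R, pi[) f y.
  by rewrite integral_itv_bndoo//; exact: measurable_funS mf.
have -> : \int[mu]_(y in `[0%R, pi[) f (circle_dist 0 y) = \int[mu]_(y in `]0%R, pi[) f y.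
  rewrite -(bd true true); apply: eq_integral => y; rewrite inE/= in_itv/= => /andP[y0 ypi].
  by rewrite circle_dist0_small// y0 ltW.
have -> : \int[mu]_(y in `[pi, T[) f (circle_dist 0 y) = \int[mu]_(y in `]0%R, pi[) f y.
  transitivity (\int[mu]_(y in `[pi, T[) f (T - y)%R).
    apply: eq_integral => y; rewrite inE/= in_itv/= => /andP[y0 ypi].
    by rewrite circle_dist0_large// y0 ltW.
  pose g x := f (- x)%R.
  have mg : measurable_fun setT g.
    by apply: measurableT_comp => //; exact: oppr_measurable.
  rewrite (_ : `[pi, T[%classic = (fun x => x + - T)%R @^-1` `[(- pi)%R, 0%R[%classic); last first.
    apply/seteqP; split => x /=; rewrite !in_itv/= subr_lt0 lerBrDr;
      by rewrite (_ : - pi + T = pi)%R//; ring.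
  transitivity (\int[mu]_(y in (fun x => x + - T)%R @^-1` `[(- pi)%R, 0%R[%classic) g (y + - T)%R).
    by apply: eq_integral => y _; rewrite /g opprD opprK addrC.
  rewrite ge0_integral_shift//; last by move=> x; exact: f0.
  rewrite -(bd false false) -(@ge0_integral_reflect `]0%R, pi])//.
  suff -> : -%R @^-1` `]0%R, pi]%classic = `[(- pi)%R, (0:R)%R[%classic by [].
  by apply/seteqP; split => x /=; rewrite !in_itv/= oppr_gt0 lerNl andbC.
by rewrite mule_natl mule2n.
Qed.

Lemma integral_torus_circle_dist (f : R -> \bar R) : measurable_fun setT f ->
  (forall y, 0 <= f y) ->
  \int[mu \x mu]_(z in @torus R) f (circle_dist z.1 z.2) =
    2%:E * \int[mu]_(y in `]0%R, pi[) (T%:E * f y).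
Proof.
move=> mf f0; rewrite integral_circle_dist// (@integral_circle_dist0 (fun y => T%:E * f y))//.
  exact: measurable_funeM.
by move=> y; rewrite mule_ge0// lee_fin ltW// period_gt0.
Qed.

Lemma measurable_torus : measurable (@torus R).
Proof. by apply: measurableX; exact: measurable_itv. Qed.

Lemma integrable_circle_dist (f : R -> R) : measurable_fun setT f ->
  mu.-integrable `]0%R, pi[ (EFin \o f) ->
  (mu \x mu).-integrable (@torus R) (fun z => (f (circle_dist z.1 z.2))%:E).
Proof.
move=> mf /integrableP[_ fi]; apply/integrableP; split.
  apply: (@measurable_funS _ _ _ _ setT) => //.
  by apply/measurable_EFinP; apply: measurableT_comp => //; exact: measurable_circle_dist.
rewrite (@integral_torus_circle_dist (fun y => `|(f y)%:E|))//; last first.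
  by apply: measurableT_comp => //; exact/measurable_EFinP.
have mI : measurable (`]0%R, pi[%classic : set R) by exact: measurable_itv.
rewrite ge0_integralZl//; last 2 first.
- by apply: measurable_funTS; apply: measurableT_comp => //; exact/measurable_EFinP.
- by rewrite lee_fin ltW// period_gt0.
by rewrite lte_mul_pinfty// lte_mul_pinfty// lee_fin ltW// period_gt0.
Qed.

(** Integrating the indicator of a null set shows that its preimage under the circle distance is
    null. The points [0] and [pi] are added to the null set to keep the distance strictly between
    them. *)
Lemma ae_circle_dist (P : R -> Prop) :
  {ae mu, forall y, (0 < y < pi)%R -> P y} ->
  {ae mu \x mu, forall z, @torus R z ->
    (0 < circle_dist z.1 z.2 < pi)%R /\ P (circle_dist z.1 z.2)}.
Proof.
move=> [N [mN N0 PN]].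
pose N' := N `|` ([set 0%R] `|` [set (pi : R)]).
have mN' : measurable N' by apply: measurableU => //; apply: measurableU; exact: measurable_set1.
have N'0 : mu N' = 0.
  have mU0 (A B : set R) : measurable A -> measurable B -> mu A = 0 -> mu B = 0 ->
      mu (A `|` B) = 0.
    by move=> mA mB A0 B0; rewrite -A0; exact: measureU0.
  have m1 (x : R) : measurable [set x] by exact: measurable_set1.
  have z1 (x : R) : mu [set x] = 0 by exact: lebesgue_measure_set1.
  by apply: (mU0) => //; [exact: measurableU|exact: mU0].
pose d (z : R * R) := circle_dist z.1 z.2.
have mB : measurable (d @^-1` N').
  by rewrite -[X in measurable X]setTI; exact: measurable_circle_dist.
exists (d @^-1` N' `&` @torus R); split.
- by apply: measurableI => //; exact: measurable_torus.
- have mI : measurable (`]0%R, pi[%classic : set R) by exact: measurable_itv.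
  rewrite -(@integral_indic _ _ _ (mu \x mu) _ measurable_torus _ mB).
  have mi : measurable_fun setT (fun y => (\1_N' y)%:E : \bar R).
    by apply/measurable_EFinP; exact: measurable_indic.
  rewrite (@integral_torus_circle_dist (fun y => (\1_N' y)%:E))//.
  rewrite ge0_integralZl//; last 2 first.
  + exact: measurable_funTS mi.
  + by rewrite lee_fin ltW// period_gt0.
  suff -> : \int[mu]_(x in `]0%R, pi[) (\1_N' x)%:E = 0 by rewrite !mule0.
  rewrite integral_indic//; apply/eqP; rewrite eq_le measure_ge0 andbT.
  rewrite -N'0; apply: le_measure; rewrite ?inE//; exact: measurableI.
move=> z /= nz; apply: contrapT => zN; apply: nz => tz.
have dz0 : (0 < d z)%R.
  rewrite lt_def circle_dist_ge0 andbT; apply/eqP => d0.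
  by apply: zN; split => //; right; left.
have dzpi : (d z < pi)%R.
  rewrite lt_def circle_dist_le_pi andbT; apply/eqP => dpi.
  by apply: zN; split => //; right; right.
split; first by rewrite dz0.
apply: contrapT => nP; apply: zN; split => //; left; apply: PN => /= h.
by apply: nP; apply: h; rewrite dz0.
Qed.

End torus_distance.

(** * Chords and energy of round circles *)

Section round_circles.
Set Implicit Arguments.
Unset Strict Implicit.
Context (R : realType) (n : nat).

Lemma round_circle1_chord (c : R -> 'rV[R]_n) s t : round_circle1 c ->
  enorm (c s - c t) ^+ 2 = 2 - 2 * cos (s - t).
Proof.
move=> [p [u [v [u1 v1 uv cE]]]].
have -> : c s - c t = (cos s - cos t) *: u + (sin s - sin t) *: v.
  by apply/rowP => i; rewrite !cE !mxE; ring.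
rewrite sqr_enorm !(dotmulDl, dotmulDr, dotmulZl, dotmulZr) (dotmulC v u) uv.
rewrite -!sqr_enorm u1 v1 cosB.
have := cos2Dsin2 s; have := cos2Dsin2 t.
move: (cos s) (sin s) (cos t) (sin t) => a b d e h1 h2.
rewrite !expr2 in h1 h2 *; lra.
Qed.

Lemma unit_circle_round : (2 <= n)%N -> round_circle1 (unit_circle (R := R) n).
Proof.
move=> n2.
pose e k : 'rV[R]_n := \row_(i < n) (val i == k)%:R.
have ee k l : (k < n)%N -> dotmul (e k) (e l) = (k == l)%:R.
  move=> kn; rewrite /dotmul (bigD1 (Ordinal kn))//= !mxE/= eqxx mul1r.
  rewrite big1 ?addr0// => i /eqP ik; rewrite !mxE.
  by case: eqP => [ik'|_]; rewrite ?mul0r//; case: ik; exact: val_inj.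
have n0 : (0 < n)%N by exact: ltn_trans n2.
exists 0, (e 0%N), (e 1%N); split.
- by rewrite /enorm ee// sqrtr1.
- by rewrite /enorm ee// sqrtr1.
- by rewrite ee.
move=> t; apply/rowP => i; rewrite !mxE add0r.
by case: (val i) => [|[|k]]/=; rewrite ?mulr1 ?mulr0 ?addr0 ?add0r.
Qed.

Lemma energy_round (F : R -> R -> R) (c c' : R -> 'rV[R]_n) :
  round_circle1 c -> round_circle1 c' -> energy F c = energy F c'.
Proof.
move=> rc rc'; apply: eq_integral => z _; rewrite /energy_density.
suff -> : enorm (c z.1 - c z.2) = enorm (c' z.1 - c' z.2) by [].
apply/eqP; rewrite -(@eqrXn2 _ 2) ?enorm_ge0//.
by rewrite !round_circle1_chord.
Qed.

End round_circles.

(* [p] stands for [F (sqrt a0(y), y)] with [a0(y) = 2 - 2 cos y] the squared chord of the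
   unit circle, and [- w y] for a slope of a supporting line at [a0(y)]. *)
Definition supporting_lines (R : realType) (F : R -> R -> R) (p w : R -> R) :=
  [/\ measurable_fun setT p, measurable_fun setT w & forall y, 0 <= w y] /\
  [/\ {ae @lebesgue_measure R, forall y, 0 < y < pi ->
         [/\ 0 < w y, F (Num.sqrt (2 - 2 * cos y)) y = p y &
            forall x, 0 < x <= y ^+ 2 ->
              p y + w y * (2 - 2 * cos y - x) <= F (Num.sqrt x) y]},
      (@lebesgue_measure R).-integrable `]0, pi[ (EFin \o p) &
      (@lebesgue_measure R).-integrable `]0, pi[
        (EFin \o (fun y => w y * (y ^+ 2 - (2 - 2 * cos y))))].

(** * From supporting lines to the energy inequality and its equality case *)

Section energy_lower_bound.
Set Implicit Arguments.
Unset Strict Implicit.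
Context (R : realType) (n : nat) (F : R -> R -> R) (p w : R -> R).
Local Notation mu := (@lebesgue_measure R).
Local Notation T := (@pi R *+ 2).
Hypothesis hn : (2 <= n)%N.
Hypothesis lines : supporting_lines F p w.

Let a0 (y : R) : R := 2 - 2 * cos y.
Let W (y : R) : R := w y * (y ^+ 2 - a0 y).
Let d (z : R * R) : R := circle_dist z.1 z.2.
(** The supporting line at squared chord [d z ^+ 2], the largest possible one: almost everywhere an
    integrable lower bound of the energy density, the same for all curves. What the line adds to it
    is nonnegative: [W] for the unit circle, [v] below for [c]. *)
Let q (z : R * R) : R := p (d z) - W (d z).

Let mw : measurable_fun setT w. Proof. by case: lines => -[]. Qed.
Let w_ge0 y : 0 <= w y. Proof. by case: lines => -[]. Qed.

Let ma0 : measurable_fun setT a0.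
Proof.
apply: measurable_funB => //; apply: measurable_funM => //.
exact: continuous_measurable_fun (@continuous_cos R).
Qed.

Let mW : measurable_fun setT W.
Proof.
apply: measurable_funM => //; apply: measurable_funB => //.
Qed.

Let W_ge0 y : 0 <= y -> 0 <= W y.
Proof. by move=> y0; rewrite mulr_ge0// subr_ge0 chord_le_sqr. Qed.

Let integrable_q : (leb2 R).-integrable (@torus R) (EFin \o q).
Proof.
case: lines => -[mp _ _] [_ ip iW].
apply: (@integrable_circle_dist _ (fun y => p y - W y)); first exact: measurable_funB.
have mI : measurable (`]0, pi[%classic : set (measurableTypeR R)) by exact: measurable_itv.
exact: (eq_integrable mI _ _ _ (integrableB mI ip iW)).
Qed.

Let integrable_W : (leb2 R).-integrable (@torus R) (fun z => (W (d z))%:E).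
Proof. by case: lines => _ [_ _ iW]; exact: integrable_circle_dist. Qed.

Let energy_unit_circle : energy F (unit_circle n) =
  (\int[leb2 R]_(z in @torus R) (q z)%:E + \int[leb2 R]_(z in @torus R) (W (d z))%:E)%E.
Proof.
rewrite -integralD//; last exact: measurable_torus.
apply: ae_eq_integral_nonmeasurable.
case: lines => _ [h _ _]; apply: ae_imply (ae_circle_dist h) => z hz tz.
have [dz [_ Fp _]] := hz tz.
rewrite /energy_density -EFinD /q subrK -Fp; congr ((F _ _)%:E).
rewrite cos_circle_dist -(round_circle1_chord _ _ (unit_circle_round R hn)).
by rewrite sqrtr_sqr ger0_norm ?enorm_ge0.
Qed.

Section curve.
Variable c : R -> 'rV[R]_n.
Hypothesis cc : closed_unit_speed c.

Let v (z : R * R) : R := w (d z) * (d z ^+ 2 - enorm (c z.1 - c z.2) ^+ 2).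

Let mv : measurable_fun setT v.
Proof.
have md := @measurable_circle_dist R.
apply: measurable_funM; first exact: measurableT_comp.
apply: measurable_funB; first exact: measurable_funX.
exact: measurable_chord.
Qed.

Let v_ge0 z : 0 <= v z.
Proof.
rewrite mulr_ge0// subr_ge0 ler_sqr ?nnegrE ?enorm_ge0 ?circle_dist_ge0//.
exact: enorm_le_circle_dist.
Qed.

(** [g1] and [g0] are the integrals of [v] and [W] over the base point, at fixed offset [y]. Their
    comparison is the mean chord inequality. *)
Let g1 (y : R) : R := w (circle_dist 0 y) * (T * circle_dist 0 y ^+ 2 - mean_chord c y).
Let g0 (y : R) : R := w (circle_dist 0 y) * (T * circle_dist 0 y ^+ 2 - T * a0 y).

Let mwD : measurable_fun setT (fun y => w (circle_dist 0 y)).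
Proof. by apply: measurableT_comp => //; exact: measurable_circle_dist0. Qed.

Let mTD : measurable_fun setT (fun y => T * circle_dist (0 : R) y ^+ 2).
Proof.
by apply: measurable_funM => //; apply: measurable_funX; exact: measurable_circle_dist0.
Qed.

Let mA : measurable_fun setT (mean_chord c).
Proof. exact: continuous_measurable_fun (mean_chord_continuous cc). Qed.

Let integral_v : (\int[leb2 R]_(z in @torus R) (v z)%:E =
  \int[mu]_(y in `[0%R, T[) (g1 y)%:E)%E.
Proof.
rewrite (@integral_torus_shear _ (EFin \o v)) /=; last 3 first.
- by apply/measurable_EFinP.
- by move=> z; rewrite lee_fin.
- by move=> s t; rewrite /v /d /= circle_dist_periodic (closed_unit_speed_periodic cc).
apply: eq_integral => y _.
have -> : (fun s => (v (s, s + y))%:E) = (fun s => (w (circle_dist 0 y))%:E *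
    (circle_dist 0 y ^+ 2 - enorm (c (s + y) - c s) ^+ 2)%:E)%E.
  apply/funext => s; rewrite /v /d /= circle_dist_shift addrAC subrr add0r.
  by rewrite enormB EFinM.
have mI : measurable (`[0, T[%classic : set (measurableTypeR R)) by exact: measurable_itv.
have ic : mu.-integrable `[0, T[ (EFin \o (fun s => enorm (c (s + y) - c s) ^+ 2)).
  by apply: eq_integrable (integrable_chord cc y 0) => // s _ /=; rewrite addr0.
have ik : mu.-integrable `[0, T[ (EFin \o cst (circle_dist 0 y ^+ 2)).
  exact: (@bounded_integrable_period _ _ `|circle_dist 0 y ^+ 2|).
have ib : mu.-integrable `[0, T[
    (fun s => (circle_dist 0 y ^+ 2 - enorm (c (s + y) - c s) ^+ 2)%:E).
  exact: (eq_integrable mI _ _ _ (integrableB mI ik ic)).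
rewrite integralZl// /g1 EFinM; congr (_ * _)%E.
have -> : T * circle_dist 0 y ^+ 2 = \int[mu]_(s in `[0, T[) circle_dist 0 y ^+ 2.
  by rewrite Rintegral_cst// [fine _](congr1 fine (lebesgue_measure_period R)) mulrC.
by rewrite -RintegralB// /Rintegral fineK//; exact: integrable_fin_num.
Qed.

Let integral_W : (\int[leb2 R]_(z in @torus R) (W (d z))%:E =
  \int[mu]_(y in `[0%R, T[) (g0 y)%:E)%E.
Proof.
transitivity (\int[leb2 R]_(z in @torus R) `|(W (d z))%:E|)%E.
  by apply: eq_integral => z _; rewrite gee0_abs// lee_fin W_ge0 ?circle_dist_ge0.
rewrite (@integral_circle_dist _ (fun y => `|(W y)%:E|)%E)//; last first.
  by apply: measurableT_comp => //; exact/measurable_EFinP.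
apply: eq_integral => y _.
rewrite gee0_abs ?lee_fin ?W_ge0 ?circle_dist_ge0// -EFinM; congr EFin.
by rewrite /W /g0 /a0 cos_circle_dist sub0r cosN; ring.
Qed.

Let g0_ge0 y : 0 <= g0 y.
Proof.
rewrite mulr_ge0// -mulrBr mulr_ge0 ?(ltW (period_gt0 R))// subr_ge0.
have -> : a0 y = a0 (circle_dist 0 y) by rewrite /a0 cos_circle_dist sub0r cosN.
exact: chord_le_sqr (circle_dist_ge0 _ _).
Qed.

Let g0_le_g1 y : g0 y <= g1 y.
Proof. by rewrite ler_wpM2l// lerB// mean_chord_le. Qed.

Let energy_ge : (\int[leb2 R]_(z in @torus R) (q z)%:E +
  \int[mu]_(y in `[0%R, T[) (g1 y)%:E <= energy F c)%E.
Proof.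
rewrite -integral_v -integralD_ge0//; last 3 first.
- exact: measurable_torus.
- by apply: measurable_funTS; exact/measurable_EFinP.
- by move=> z _; rewrite lee_fin.
apply: ae_le_integral_nonmeasurable.
case: lines => _ [h _ _].
apply: ae_imply2 (ae_circle_dist h) (self_intersections_null cc) => z hz cz tz.
have [dz [_ _ line]] := hz tz.
have x0 : 0 < enorm (c z.1 - c z.2) ^+ 2.
  rewrite exprn_gt0// lt_def enorm_ge0 andbT; apply/eqP => /enorm_eq0/eqP.
  by rewrite subr_eq0 => /eqP.
have xd : enorm (c z.1 - c z.2) ^+ 2 <= d z ^+ 2.
  rewrite ler_sqr ?nnegrE ?enorm_ge0 ?circle_dist_ge0//; exact: enorm_le_circle_dist.
have := line _ (introT andP (conj x0 xd)).
rewrite sqrtr_sqr ger0_norm ?enorm_ge0// /energy_density -EFinD lee_fin.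
apply: le_trans; rewrite /q /v /W /a0 le_eqVlt; apply/orP; left; apply/eqP; ring.
Qed.

Lemma energy_unit_circle_le : (energy F (unit_circle n) <= energy F c)%E.
Proof.
rewrite energy_unit_circle integral_W; apply: le_trans energy_ge.
rewrite leeD2l//; apply: ae_le_integral_nonmeasurable; apply: aeW => y _.
by rewrite lee_fin.
Qed.

(** The energy of the unit circle is finite, so equality can be cancelled down to a zero integral of
    [g1 - g0 >= 0]. Positivity of [w] turns this into equality of mean chords almost everywhere on
    []0, pi[], and continuity, reflection and periodicity extend it to all offsets. *)
Lemma energy_eq_round : energy F c = energy F (unit_circle n) -> round_circle1 c.
Proof.
move=> eqE; apply: unit_speed_round => //.
have mI : measurable (`[0, T[%classic : set (measurableTypeR R)) by exact: measurable_itv.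
have mg0 : measurable_fun setT g0.
  apply: measurable_funM => //; apply: measurable_funB => //; exact: measurable_funM.
have mg1 : measurable_fun setT g1.
  by apply: measurable_funM => //; apply: measurable_funB.
have qfin : (\int[leb2 R]_(z in @torus R) (q z)%:E)%E \is a fin_num.
  by apply: integrable_fin_num => //; exact: measurable_torus.
have Wfin : (\int[mu]_(y in `[0%R, T[) (g0 y)%:E)%E \is a fin_num.
  by rewrite -integral_W; apply: integrable_fin_num => //; exact: measurable_torus.
have : (\int[mu]_(y in `[0%R, T[) (g1 y)%:E <= \int[mu]_(y in `[0%R, T[) (g0 y)%:E)%E.
  by have := energy_ge; rewrite eqE energy_unit_circle integral_W leeD2lE.
have -> : (\int[mu]_(y in `[0%R, T[) (g1 y)%:E =
   \int[mu]_(y in `[0%R, T[) (g0 y)%:E + \int[mu]_(y in `[0%R, T[) (g1 y - g0 y)%:E)%E.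
  rewrite -ge0_integralD//.
  - by apply: eq_integral => y _; rewrite -EFinD addrC subrK.
  - by move=> y _; rewrite lee_fin.
  - by apply: measurable_funTS; exact/measurable_EFinP.
  - by move=> y _; rewrite lee_fin subr_ge0.
  - by apply: measurable_funTS; apply/measurable_EFinP; exact: measurable_funB.
rewrite -[leRHS]adde0 leeD2lE// => int_le0.
have : (\int[mu]_(y in `[0%R, T[) `|(g1 y - g0 y)%:E| = 0)%E.
  apply/eqP; rewrite eq_le; apply/andP; split.
    by under eq_integral => y _ do rewrite gee0_abs ?lee_fin ?subr_ge0//.
  by apply: integral_ge0.
have mg10 : measurable_fun `[0%R, T[ (fun y => (g1 y - g0 y)%:E).
  by apply: measurable_funTS; apply/measurable_EFinP; exact: measurable_funB.
move/(ae_eq_integral_abs mu mI mg10).1 => g10.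
have ca : continuous (fun y => T * a0 y).
  move=> x; apply: cvgM; first exact: cvg_cst.
  apply: cvgB; first exact: cvg_cst.
  by apply: cvgM; [exact: cvg_cst|exact: continuous_cos].
have cA := mean_chord_continuous cc.
have pi0 := pi_gt0 R; have pipi : (pi : R) < T by rewrite mulr2n ltrDl.
have eq_half y : 0 < y < pi -> mean_chord c y = T * a0 y.
  apply: (ae_eq_continuous cA ca); case: lines => _ [h _ _].
  apply: ae_imply2 h g10 => x hx g10x x0pi.
  have /andP[x0 xpi] := x0pi.
  have [wx _ _] := hx x0pi.
  have /g10x : `[0, T[%classic x by rewrite /= in_itv/= ltW// (lt_trans xpi).
  move=> /= [] /eqP; rewrite /g1 /g0 circle_dist0_small; last by rewrite !ltW.
  rewrite -mulrBr mulf_eq0 gt_eqF//= => /eqP; lra.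
(* Reflection carries []0, pi[] to []pi, T[]; the point [pi] left out is recovered by continuity, as
   a null exception. *)
have eq_open y : 0 < y < T -> mean_chord c y = T * a0 y.
  apply: (ae_eq_continuous cA ca).
  exists [set pi]; split; [exact: measurable_set1|exact: lebesgue_measure_set1|].
  move=> x /= nx; apply: contrapT => x_pi; apply: nx => /andP[x0 xT].
  have [xpi|pix|//] := ltrgtP x pi; first by apply: eq_half; rewrite x0.
  rewrite -(mean_chordN cc) -(mean_chord_periodic cc) (_ : - x + T = T - x); last by rewrite addrC.
  rewrite eq_half; last by apply/andP; split; lra.
  by rewrite /a0 (addrC T) cosD2pi cosN.
move=> y; have [k /andP[k0 kT]] := period_representative y.
rewrite -(periodicMz k (mean_chord_periodic cc)) -(periodicMz k (@cosD2pi R)).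
have [->|y0] := eqVneq (y + T *~ k) 0; last by apply: eq_open; rewrite kT lt_def y0 k0.
apply/eqP; rewrite cos0 mulr1 subrr mulr0 eq_le; apply/andP; split.
  by have := mean_chord_le_sqr cc 0; rewrite expr0n mulr0.
by apply: Rintegral_ge0 => s _; exact: sqr_ge0.
Qed.

End curve.

End energy_lower_bound.

(** * Antiderivatives on the whole line *)

Section antiderivative.
Set Implicit Arguments.
Unset Strict Implicit.
Context (R : realType).
Local Notation mu := (@lebesgue_measure R).
Implicit Types (f : R -> R) (a b x y : R).

Lemma continuous_integrable_itv f a b : continuous f ->
  mu.-integrable `[a, b] (EFin \o f).
Proof.
move=> cf; apply: continuous_compact_integrable; first exact: segment_compact.
exact: continuous_subspaceT.
Qed.

Lemma antiderivative_exists f : continuous f ->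
  exists G : R -> R, forall x, is_derive x 1 G (f x).
Proof.
move=> cf; pose F a x := \int[mu]_(t in `[a, x]) f t.
have chasles a b x : a <= b -> b <= x -> F a x = F a b + F b x.
  move=> ab bx.
  have := @Rintegral_itvB _ f (BLeft a) (BRight x) b (continuous_integrable_itv a x cf).
  rewrite !bnd_simp => /(_ ab bx); rewrite Rintegral_itv_obnd_cbnd.
    by rewrite /F => <-; rewrite addrC subrK.
  apply: integrableS (continuous_integrable_itv b x cf); try exact: measurable_itv.
  by move=> t; rewrite /= !in_itv/= => /andP[/ltW -> ->].
(* The base point lies to the left of both [0] and [x]. Any other such base point gives the same
   value, so near a given [x] one fixed base point can be used. *)
pose G x := F (- (`|x| + 1)) x - F (- (`|x| + 1)) 0.
have GE a x : a <= 0 -> a <= x -> G x = F a x - F a 0.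
  move=> a0 ax; have := ler_norm x; have := ler_norm (- x); rewrite normrN => h1 h2.
  have := normr_ge0 x => h3.
  rewrite /G; set b := - (_ + 1).
  have b0 : b <= 0 by rewrite /b; lra.
  have bx : b <= x by rewrite /b; lra.
  by have [ab|/ltW ba] := leP a b;
    [rewrite (chasles a b x)// (chasles a b 0)//|rewrite (chasles b a x)// (chasles b a 0)//]; ring.
exists G => x.
pose a := - (`|x| + 2).
have h1 := ler_norm x; have h2 := ler_norm (- x); have h3 := normr_ge0 x.
rewrite normrN in h2.
have ax : a < x by rewrite /a; lra.
have xx1 : x < x + 1 by rewrite ltrDl.
have [dF F'] := continuous_FTC1_closed xx1 (continuous_integrable_itv a (x + 1) cf) ax (cf x).
have dFx : is_derive x 1 (fun y => F a y - F a 0) (f x).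
  rewrite -[f x]subr0; apply: is_deriveB.
  by apply: DeriveDef => //; rewrite -derive1E.
apply: near_eq_is_derive dFx; near=> y.
rewrite (GE a)//; first by rewrite /a; lra.
have : `|x - y| < 1 by near: y; apply: cvgr_dist_lt.
by rewrite ltr_distlC /a; lra.
Unshelve. all: by end_near.
Qed.

End antiderivative.

(** * The tangent angle of the stadium *)

Section stadium_angle.
Set Implicit Arguments.
Unset Strict Implicit.
Context (R : realType).
Local Notation T := (@pi R *+ 2).
Implicit Types (s t u : R).

(* Tangent angle of the stadium of perimeter 2 pi: half circles of radius 1/2, for t in
   [pi/4, 3pi/4] and [5pi/4, 7pi/4], joined by segments of length pi/2. *)
Definition stadium_angle t : R := t + (circle_dist 0 (t *+ 2 - pi / 2) - pi / 2) / 2.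

(** As a function of [t] the triangular wave in [stadium_angle] has slope 2 or -2. Half of it, added
    to [t], gives curvature 2 on the half circles and 0 on the sides. *)
Lemma stadium_angle_cap t : pi / 4 <= t <= 3 * (pi / 4) ->
  stadium_angle t = t *+ 2 - pi / 2.
Proof.
by move=> /andP[h1 h2]; rewrite /stadium_angle circle_dist0_small; lra.
Qed.

Lemma stadium_angle_side t : 3 * (pi / 4) <= t <= 5 * (pi / 4) -> stadium_angle t = pi.
Proof.
by move=> /andP[h1 h2]; rewrite /stadium_angle circle_dist0_large; lra.
Qed.

Lemma stadium_angleDpi t : stadium_angle (t + pi) = stadium_angle t + pi.
Proof.
rewrite /stadium_angle (_ : (t + pi) *+ 2 - pi / 2 = t *+ 2 - pi / 2 + T); last by ring.
by rewrite circle_dist_periodic; ring.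
Qed.

Lemma stadium_angle_nondecreasing s t : s <= t -> stadium_angle s <= stadium_angle t.
Proof.
move=> st; have := circle_dist_lipschitz (s *+ 2 - pi / 2) (t *+ 2 - pi / 2).
rewrite (_ : s *+ 2 - pi / 2 - _ = - (2 * (t - s))); last by ring.
have h : 0 <= 2 * (t - s) by lra.
by rewrite normrN (ger0_norm h) ler_norml /stadium_angle => /andP[]; lra.
Qed.

Lemma stadium_angle_lipschitz s t : `|stadium_angle s - stadium_angle t| <= 2 * `|s - t|.
Proof.
wlog st : s t / s <= t => [hw|].
  by have [/hw//|/ltW/hw] := leP s t; rewrite distrC (distrC t).
rewrite distrC (distrC s) !ger0_norm ?subr_ge0 ?stadium_angle_nondecreasing//.
have := circle_dist_lipschitz (s *+ 2 - pi / 2) (t *+ 2 - pi / 2).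
rewrite (_ : s *+ 2 - pi / 2 - _ = - (2 * (t - s))); last by ring.
have h : 0 <= 2 * (t - s) by lra.
by rewrite normrN (ger0_norm h) ler_norml /stadium_angle => /andP[]; lra.
Qed.

Lemma stadium_angle_continuous : continuous stadium_angle.
Proof.
move=> x; apply/cvgrPdist_le => /= e e0; have e2 : 0 < e / 2 by rewrite divr_gt0.
near=> y; apply: le_trans (stadium_angle_lipschitz _ _) _.
rewrite mulrC -ler_pdivlMr; last by [].
near: y; exact: cvgr_dist_le.
Unshelve. all: by end_near.
Qed.

(* Around pi/2, the middle of a half circle, and around pi, the middle of a side. *)
Lemma stadium_angle_mid_cap u : 0 < u < pi / 2 ->
  exists2 a, u < a <= pi / 2 &
    stadium_angle (pi / 2 + u) = pi / 2 + a /\ stadium_angle (pi / 2 - u) = pi / 2 - a.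
Proof.
move=> /andP[u0 upi]; have [u4|u4] := leP u (pi / 4).
  exists (u *+ 2); first by lra.
  by rewrite !stadium_angle_cap; lra.
exists (pi / 2); first by lra.
rewrite stadium_angle_side; last by lra.
split; first by lra.
have := stadium_angleDpi (pi / 2 - u); rewrite stadium_angle_side; lra.
Qed.

Lemma stadium_angle_mid_side u : 0 < u < pi / 2 ->
  exists2 a, 0 <= a < u &
    stadium_angle (pi + u) = pi + a /\ stadium_angle (pi - u) = pi - a.
Proof.
move=> /andP[u0 upi]; have [u4|u4] := leP u (pi / 4).
  by exists 0; [lra|rewrite !stadium_angle_side; lra].
exists (u *+ 2 - pi / 2); first by lra.
rewrite addrC stadium_angleDpi !stadium_angle_cap; lra.
Qed.

End stadium_angle.

(** * Numerical estimates for chords that start near the beginning of a half circle *)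

Section near_cap_arithmetic.
Set Implicit Arguments.
Unset Strict Implicit.
Context (R : realType).

(** Read [z = y - pi / 2] and [sz = sin z]; [k] is the distance of the base point from the beginning
    of the half circle. Up to thousandths the right side is at least [1 + 2 * z - 23 / 15 * z ^+ 2],
    a concave function that exceeds [27 / 100] on [[0, 8 / 5]]; the difference from [11 / 50]
    absorbs the errors. *)
Lemma near_cap_arithmetic (z k sz dx dy : R) : 0 <= k <= 1000^-1 -> - k <= z <= 8 / 5 ->
  z - z ^+ 2 * (4 / 15) - 1000^-1 <= sz ->
  - (z + 2 * k) <= dx <= z + 2 * k -> -1 <= dy <= 1 ->
  11 / 50 <= 2 - 2 * - sz - (dx ^+ 2 + dy ^+ 2).
Proof.
move=> /andP[k0 k1] /andP[zk z8] sz_ge dx_le dy_le.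
have zz : z ^+ 2 <= 8 / 5 * z + 500^-1.
  have [z0|z0] := leP 0 z.
    have : z * z <= 8 / 5 * z by rewrite ler_wpM2r.
    lra.
  have : (- z) * (- z) <= 1000^-1 * 1000^-1 by apply: ler_pM; lra.
  lra.
have kz : k * z <= 1000^-1 * (8 / 5).
  apply: (@le_trans _ _ (k * (8 / 5))); first by rewrite ler_wpM2l.
  lra.
have kk : k * k <= 1000^-1 * 1000^-1 by apply: ler_pM.
have h1 : dx ^+ 2 <= (z + 2 * k) ^+ 2.
  have zk0 : 0 <= z + 2 * k by lra.
  by rewrite -(real_normK (num_real dx)) ler_sqr ?nnegrE ?ler_norml.
have h2 : dy ^+ 2 <= 1 ^+ 2.
  by rewrite -(real_normK (num_real dy)) ler_sqr ?nnegrE ?ler_norml.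
lra.
Qed.

(** [p] stands for [pi]. The displacement is split at the end of the half circle: [dx1], [dy1] along
    the arc and [dx2], [dy2] after it. *)
Lemma near_cap_coordinates (p s y sz sk ck dx dy dx1 dy1 dx2 dy2 : R) :
  2 <= p < 16 / 5 -> p / 4 <= s <= p / 4 + 1000^-1 -> 3 * (p / 4) < s + y -> y < p ->
  (y - p / 2) - (y - p / 2) ^+ 2 * (4 / 15) - 1000^-1 <= sz ->
  0 <= sk <= 2 * (s - p / 4) -> 0 <= ck <= 1 ->
  dx = dx1 + dx2 -> dx1 = - sk / 2 -> 3 * (p / 4) - (s + y) <= dx2 <= 0 ->
  dy = dy1 + dy2 -> dy1 = (ck + 1) / 2 -> - 2^-1 <= dy2 <= 0 ->
  11 / 50 <= 2 - 2 * - sz - (dx ^+ 2 + dy ^+ 2).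
Proof.
move=> /andP[p2 p16] /andP[s4 s4'] sy yp sz_ge /andP[sk0 sk1] /andP[c0 c1].
move=> -> -> /andP[x2 x20] -> -> /andP[y2 y20].
apply: (@near_cap_arithmetic (y - p / 2) (s - p / 4)) => //.
- by apply/andP; split; [move: s4; clear|move: s4'; clear]; lra.
- by apply/andP; split; [move: sy; clear|move: yp p16; clear]; lra.
- by apply/andP; split; [move: x2 sk1; clear|move: x20 sk0 sy s4; clear]; lra.
- by apply/andP; split; [move: c0 y2; clear|move: c1 y20; clear]; lra.
Qed.

End near_cap_arithmetic.

(** * The stadium: closing up, injectivity and chords *)

Section stadium.
Set Implicit Arguments.
Unset Strict Implicit.
Context (R : realType) (X Y : R -> R).
Local Notation T := (@pi R *+ 2).
Local Notation theta := (@stadium_angle R).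
Hypothesis dX : forall t : R, is_derive t 1 X (cos (theta t)).
Hypothesis dY : forall t : R, is_derive t 1 Y (sin (theta t)).
Implicit Types (s t u y : R).

Definition planar_chord s t := (X s - X t) ^+ 2 + (Y s - Y t) ^+ 2.

Lemma planar_chordC s t : planar_chord s t = planar_chord t s.
Proof. by rewrite /planar_chord -sqrrN opprB -[X in _ + X]sqrrN opprB. Qed.

Lemma eq_of_derive (f g df dg : R -> R) (a b : R) : a <= b ->
  (forall x : R, is_derive x 1 f (df x)) -> (forall x : R, is_derive x 1 g (dg x)) ->
  (forall x, a < x < b -> df x = dg x) -> f b - f a = g b - g a.
Proof.
move=> ab hf hg e; apply/eqP; rewrite eq_le; apply/andP; split.
  by apply: (le_of_derive ab hf hg) => x /e ->.
by apply: (le_of_derive ab hg hf) => x /e ->.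
Qed.

Lemma is_derive_shift (f df : R -> R) (a t : R) :
  (forall t : R, is_derive t 1 f (df t)) -> is_derive t 1 (fun t => f (t + a)) (df (t + a)).
Proof.
move=> hf; have h : is_derive t 1 (fun t => t + a) 1.
  by apply: is_derive_eq; rewrite addr0.
have := @is_derive1_comp _ f (fun t => t + a) t (df (t + a)) 1 (hf _) h.
by rewrite mulr1.
Qed.

Lemma is_derive_centered (f df : R -> R) (a t : R) :
  (forall t : R, is_derive t 1 f (df t)) ->
  is_derive t 1 (fun t => f (a + t) - f (a - t)) (df (a + t) + df (a - t)).
Proof.
move=> hf; have h : is_derive t 1 (fun t => a - t) (-1).
  by have := is_deriveB (is_derive_cst a t 1) (is_derive_id t 1); rewrite sub0r.
have h1 : is_derive t 1 (fun t => f (a + t)) (df (a + t)).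
  by have := is_derive_shift a t hf; under eq_fun do rewrite addrC; rewrite addrC.
have h2 := @is_derive1_comp _ f (fun t => a - t) t (df (a - t)) (-1) (hf _) h.
by have := is_deriveB h1 h2; rewrite mulrN1 opprK.
Qed.

(** The sum [f (t + pi) + f t] has derivative zero; its values at [t] and [t + pi] are compared. *)
Let antiperiodic (f df : R -> R) (t : R) : (forall t : R, is_derive t 1 f (df t)) ->
  (forall t, df (t + pi) = - df t) -> f (t + T) = f t.
Proof.
move=> hf df_pi.
have cst_sum (a b : R) : a <= b -> f (b + pi) + f b = f (a + pi) + f a.
  have hs (x : R) : is_derive x 1 (fun t => f (t + pi) + f t) (df (x + pi) + df x).
    exact: is_deriveD (is_derive_shift pi x hf) (hf x).
  move=> ab; have := @eq_of_derive (fun t => f (t + pi) + f t) (cst 0)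
    (fun t => df (t + pi) + df t) (cst 0) a b ab hs (fun x => is_derive_cst _ _ _).
  rewrite subrr => h; apply/eqP; rewrite -subr_eq0; apply/eqP; apply: h => x _.
  by rewrite df_pi addNr.
have := @cst_sum t (t + pi) _; rewrite lerDl pi_ge0 => /(_ isT).
by rewrite -addrA -mulr2n; lra.
Qed.

Lemma stadium_periodic t : X (t + T) = X t /\ Y (t + T) = Y t.
Proof.
split; first by apply: antiperiodic dX _ => u; rewrite stadium_angleDpi cosDpi.
by apply: antiperiodic dY _ => u; rewrite stadium_angleDpi sinDpi.
Qed.

(** Over at most half a period the tangent turns by at most [pi], hence stays within [pi / 2] of its
    mean direction [m]. The coordinate [G] along [m] is nondecreasing, and it increases strictly
    around a point where the tangent angle equals [m]. *)
Let injective_half s t : s < t -> t <= s + pi -> ~ (X s = X t /\ Y s = Y t).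
Proof.
move=> st ts [eX eY].
have st_le := stadium_angle_nondecreasing (ltW st).
have ts_le := stadium_angle_nondecreasing ts; rewrite stadium_angleDpi in ts_le.
pose m := (theta s + theta t) / 2.
pose G u := cos m * X u + sin m * Y u.
have dG (u : R) : is_derive u 1 G (cos (theta u - m)).
  have h1 : is_derive u 1 (fun u => cos m * X u) (cos m * cos (theta u)).
    by have := is_deriveZ (cos m) (dX u).
  have h2 : is_derive u 1 (fun u => sin m * Y u) (sin m * sin (theta u)).
    by have := is_deriveZ (sin m) (dY u).
  by have := is_deriveD h1 h2; rewrite cosB (mulrC (cos m)) (mulrC (sin m)).
have cos_ge0 (u : R) : s < u < t -> 0 <= cos (theta u - m).
  move=> /andP[su ut].
  have := stadium_angle_nondecreasing (ltW su); have := stadium_angle_nondecreasing (ltW ut).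
  by move=> h1 h2; apply: cos_ge0_pihalf; rewrite /m; lra.
have Gst : G s = G t by rewrite /G eX eY.
have [u uin um] : exists2 u, u \in `[s, t] & theta u = m.
  apply: IVT (ltW st) _ _; first exact: continuous_subspaceT (@stadium_angle_continuous R).
  by rewrite (min_idPl st_le) (max_idPr st_le); rewrite /m; lra.
have G_mono (a b : R) : s <= a -> a <= b -> b <= t -> G a <= G b.
  move=> sa ab bt; rewrite -subr_ge0.
  have := @le_of_derive _ (cst 0) G (cst 0) (fun u => cos (theta u - m)) a b ab
    (fun x => is_derive_cst _ _ _) dG.
  rewrite subrr; apply => x /andP[ax xb]; apply: cos_ge0.
  by rewrite (le_lt_trans sa)// (lt_le_trans xb).
have /andP[su ut] : s <= u <= t by move: uin; rewrite in_itv.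
(* Within [1 / 4] of [u] the angle, being 2-Lipschitz, differs from [m] by less than
   [1 / 2 < pi / 2]. *)
pose a := Num.max s (u - 4^-1); pose b := Num.min t (u + 4^-1).
have sa : s <= a by rewrite le_max lexx.
have bt : b <= t by rewrite ge_min lexx.
have ab : a < b by rewrite gt_max !lt_min; apply/andP; split; apply/andP; split; lra.
have ua : u - 4^-1 <= a by rewrite le_max lexx orbT.
have bu : b <= u + 4^-1 by rewrite ge_min lexx orbT.
have : G a < G b.
  rewrite -subr_gt0.
  have := @lt_of_derive _ (cst 0) G (cst 0) (fun u => cos (theta u - m)) a b ab
    (fun x => is_derive_cst _ _ _) dG.
  rewrite subrr; apply => x /andP[ax xb] /=.
  have xu : `|x - u| < 4^-1 by rewrite ltr_norml; lra.
  have := stadium_angle_lipschitz x u; rewrite um ler_norml => /andP[h1 h2].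
  by apply: cos_gt0_pihalf; have := pi_ge2 R; lra.
have := G_mono s a (lexx _) sa; have := G_mono b t; have := ltW ab; rewrite Gst.
by move=> h1 h2 h3; lra.
Qed.

Lemma stadium_injective s t : X s = X t -> Y s = Y t ->
  exists k : int, s - t = T *~ k.
Proof.
move=> eX eY.
have XT := periodicMz _ (fun u => (stadium_periodic u).1).
have YT := periodicMz _ (fun u => (stadium_periodic u).2).
have [k /andP[k0 kT]] := period_representative (s - t).
pose r := s - t + T *~ k.
have tr : t + r = s + T *~ k by rewrite /r; ring.
have eXr : X (t + r) = X t by rewrite tr XT.
have eYr : Y (t + r) = Y t by rewrite tr YT.
exists (- k); rewrite mulrNz; apply/eqP; rewrite -subr_eq0 opprK -/r.
apply/negPn/negP => rn0.
have r0 : 0 < r by rewrite lt_def rn0.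
(* Of the two arcs between the points one has length at most [pi]. *)
have [rpi|pir] := leP r pi.
  have t_lt : t < t + r by rewrite ltrDl.
  by apply: (injective_half t_lt); rewrite ?lerD2l.
have lt_tT : t + r < t + T by rewrite ltrD2l.
apply: (injective_half lt_tT); first by rewrite -addrA lerD2l mulr2n lerD2r ltW.
by rewrite (stadium_periodic t).1 (stadium_periodic t).2.
Qed.

(** By symmetry about the middle of the half circle the chord is vertical. Its length grows at rate
    [2 * cos a] with [a > u], more slowly than the [2 * cos u] of the unit circle. *)
Lemma planar_chord_cap y : 0 < y < pi ->
  planar_chord (pi / 2 - y / 2) (pi / 2 + y / 2) < 2 - 2 * cos y.
Proof.
move=> /andP[y0 ypi]; have h0 : 0 < y / 2 by lra.
have h1 u : 0 < u < y / 2 -> 0 < u < pi / 2 by move=> /andP[]; lra.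
have gX : X (pi / 2 + y / 2) - X (pi / 2 - y / 2) = 0.
  have := @eq_of_derive _ (cst 0) _ (cst 0) 0 (y / 2) (ltW h0)
    (fun u => is_derive_centered (pi / 2) u dX) (fun u => is_derive_cst _ _ _).
  rewrite !addr0 !subr0 !subrr subr0; apply => u /h1 /stadium_angle_mid_cap[a _ [-> ->]].
  by rewrite cosD cosB cos_pihalf sin_pihalf /=; ring.
have d2sin (u : R) : is_derive u 1 (fun u => 2 * sin u) (2 * cos u).
  by have := is_deriveZ 2 (is_derive_sin u).
have gY : Y (pi / 2 + y / 2) - Y (pi / 2 - y / 2) < 2 * sin (y / 2).
  have := @lt_of_derive _ _ _ _ _ 0 (y / 2) h0
    (fun u => is_derive_centered (pi / 2) u dY) d2sin.
  rewrite sin0 !addr0 mulr0 !subr0 subrr subr0; apply => u /h1 upi.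
  have /andP[u0 up] := upi.
  have [a /andP[ua api] [-> ->]] := stadium_angle_mid_cap upi.
  rewrite sinD sinB cos_pihalf sin_pihalf.
  have : cos a < cos u by apply: cos_lt_cos; lra.
  lra.
have gY0 : 0 <= Y (pi / 2 + y / 2) - Y (pi / 2 - y / 2).
  have := @le_of_derive _ (cst 0) _ (cst 0) _ 0 (y / 2) (ltW h0)
    (fun u => is_derive_cst _ _ _) (fun u => is_derive_centered (pi / 2) u dY).
  rewrite !addr0 !subr0 !subrr subr0; apply => u /h1 upi.
  have /andP[u0 up] := upi.
  have [a /andP[ua api] [-> ->]] := stadium_angle_mid_cap upi.
  rewrite sinD sinB cos_pihalf sin_pihalf /=.
  have : 0 <= cos a by apply: cos_ge0_pihalf; lra.
  lra.
rewrite chordE planar_chordC /planar_chord gX expr0n add0r.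
have -> : 4 * sin (y / 2) ^+ 2 = (2 * sin (y / 2)) ^+ 2 by ring.
by rewrite ltr_sqr ?nnegrE// ltW// (le_lt_trans gY0).
Qed.

(** Around the middle of a side the tangent turns by [a < u], so the horizontal extent alone exceeds
    the chord of the unit circle. *)
Lemma planar_chord_side y : 0 < y < pi ->
  2 - 2 * cos y < planar_chord (pi - y / 2) (pi + y / 2).
Proof.
move=> /andP[y0 ypi]; have h0 : 0 < y / 2 by lra.
have h1 u : 0 < u < y / 2 -> 0 < u < pi / 2 by move=> /andP[]; lra.
have d2sin (u : R) : is_derive u 1 (fun u => - 2 * sin u) (- 2 * cos u).
  by have := is_deriveZ (- 2) (is_derive_sin u).
have gX : X (pi + y / 2) - X (pi - y / 2) < - 2 * sin (y / 2).
  have := @lt_of_derive _ _ _ _ _ 0 (y / 2) h0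
    (fun u => is_derive_centered pi u dX) d2sin.
  rewrite sin0 !addr0 mulr0 !subr0 subrr subr0; apply => u /h1 upi.
  have /andP[u0 up] := upi.
  have [a /andP[a0 au] [-> ->]] := stadium_angle_mid_side upi.
  rewrite cosD cosB cospi sinpi.
  have : cos u < cos a by apply: cos_lt_cos; lra.
  lra.
have s0 : 0 < sin (y / 2) by apply: sin_gt0_pi; lra.
rewrite chordE planar_chordC /planar_chord.
have -> : 4 * sin (y / 2) ^+ 2 = (2 * sin (y / 2)) ^+ 2 by ring.
apply: (@lt_le_trans _ _ ((- (X (pi + y / 2) - X (pi - y / 2))) ^+ 2)); last first.
  by rewrite sqrrN lerDl sqr_ge0.
by rewrite ltr_sqr ?nnegrE; lra.
Qed.

Let is_derive_double (f df : R -> R) (t : R) : (forall t : R, is_derive t 1 f (df t)) ->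
  is_derive t 1 (fun t => f (2 * t) / 2) (df (2 * t)).
Proof.
move=> hf; have h : is_derive t 1 (fun t => 2 * t) 2.
  by have := is_deriveZ 2 (is_derive_id t 1); rewrite /GRing.scale/= mulr1.
have := is_deriveZ (2^-1) (@is_derive1_comp _ f (fun t => 2 * t) t (df (2 * t)) 2 (hf _) h).
rewrite /GRing.scale/= mulrCA mulVf// mulr1.
by congr is_derive; apply/funext => u /=; rewrite /GRing.scale/= mulrC.
Qed.

Let cap_arc s t : pi / 4 <= s -> s <= t -> t <= 3 * (pi / 4) ->
  X t - X s = (cos (2 * s) - cos (2 * t)) / 2 /\ Y t - Y s = (sin (2 * s) - sin (2 * t)) / 2.
Proof.
move=> s4 st t4.
have angle u : s < u < t -> theta u = 2 * u - pi / 2.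
  by move=> /andP[su ut]; rewrite stadium_angle_cap ?mulr_natl; lra.
have dNcos (u : R) : is_derive u 1 (fun u => - cos u) (sin u).
  by have := is_deriveN (is_derive_cos u); rewrite opprK.
have dNsin (u : R) : is_derive u 1 (fun u => - sin u) (- cos u).
  exact: is_deriveN (is_derive_sin u).
split.
  rewrite (@eq_of_derive _ _ _ _ _ _ st dX (fun u => is_derive_double u dNcos)); first by field.
  by move=> u /angle ->; rewrite cosBpihalf.
rewrite (@eq_of_derive _ _ _ _ _ _ st dY (fun u => is_derive_double u dNsin)); first by field.
by move=> u /angle ->; rewrite sinBpihalf.
Qed.

(** An offset below [pi] from a base point within [1 / 1000] of [pi / 4] passes the end of the side,
    [5 * (pi / 4)], by at most [1 / 1000]; there the tangent has turned by at most [1 / 500]. *)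
Let after_cap t : 3 * (pi / 4) <= t <= 5 * (pi / 4) + 1000^-1 ->
  3 * (pi / 4) - t <= X t - X (3 * (pi / 4)) <= 0 /\
  - 2^-1 <= Y t - Y (3 * (pi / 4)) <= 0.
Proof.
move=> /andP[t3 t5]; have pi_lt := pi_lt_16_5 R; have pi2 := pi_ge2 R.
have angle u : 3 * (pi / 4) < u < t -> 0 <= theta u - pi <= 500^-1.
  move=> /andP[su ut].
  have a3 : theta (3 * (pi / 4)) = pi by rewrite stadium_angle_side; lra.
  have a5 : theta (5 * (pi / 4)) = pi by rewrite stadium_angle_side; lra.
  have := stadium_angle_nondecreasing (ltW su); rewrite a3.
  have [u5|u5] := leP u (5 * (pi / 4)); first by rewrite stadium_angle_side; lra.
  have := stadium_angle_lipschitz u (5 * (pi / 4)); rewrite a5.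
  rewrite (gtr0_norm (_ : 0 < u - _)); last by lra.
  by rewrite ler_norml => /andP[]; lra.
have sinE u : sin (theta u) = - sin (theta u - pi) by rewrite -sinDpi subrK.
have cosE u : cos (theta u) = - cos (theta u - pi) by rewrite -cosDpi subrK.
have dlin (b : R) (u : R) : is_derive u 1 (fun u => b * u) b.
  by have := is_deriveZ b (is_derive_id u 1); rewrite /GRing.scale/= mulr1.
have dcst := fun u : R => is_derive_cst (0 : R) u (1 : R).
split; apply/andP; split.
- have := le_of_derive t3 (dlin (-1)) dX; rewrite !mulN1r => h.
  apply: le_trans (h _); first by rewrite opprK addrC.
  by move=> u _; exact: cos_geN1.
- have := le_of_derive t3 dX dcst; rewrite subrr; apply => u /angle/andP[a0 a1].
  by rewrite cosE /= oppr_le0; apply: cos_ge0_pihalf; lra.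
- have := le_of_derive t3 (dlin (- 500^-1)) dY => h.
  apply: le_trans (h _); first by lra.
  move=> u /angle/andP[a0 a1]; rewrite sinE lerN2.
  exact: le_trans (sin_le_id a0) a1.
- have := le_of_derive t3 dY dcst; rewrite subrr; apply => u /angle/andP[a0 a1].
  by rewrite sinE /= oppr_le0; apply: sin_ge0_pi; lra.
Qed.

(** If the chord ends on the same half circle, its square is [sin y ^+ 2] and the gap to the unit
    circle is [(1 - cos y) ^+ 2], of the same order [y ^+ 4] as the left side. Otherwise the gap is
    at least a positive constant while the left side is bounded. *)
Lemma planar_chord_near_cap s y : pi / 4 <= s <= pi / 4 + 1000^-1 -> 0 < y < pi ->
  y ^+ 2 - (2 - 2 * cos y) <= 50 * (2 - 2 * cos y - planar_chord s (s + y)).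
Proof.
move=> /andP[s4 sk] /andP[y0 ypi].
have pi_lt := pi_lt_16_5 R.
have := sqr_sub_chord_le (ltW y0).
have y2 : 0 < y ^+ 2 by rewrite exprn_gt0.
rewrite planar_chordC /planar_chord.
have [t4|t4] := leP (s + y) (3 * (pi / 4)).
  have sy : s <= s + y by rewrite lerDl ltW.
  have [-> ->] := cap_arc s4 sy t4.
  have -> : ((cos (2 * s) - cos (2 * (s + y))) / 2) ^+ 2 +
      ((sin (2 * s) - sin (2 * (s + y))) / 2) ^+ 2 = sin y ^+ 2.
    transitivity ((1 - cos (2 * (s + y) - 2 * s)) / 2).
      rewrite cosB; have := cos2Dsin2 (2 * s); have := cos2Dsin2 (2 * (s + y)).
      move: (cos _) (sin _) (cos _) (sin _) => a b d e h1 h2.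
      rewrite !expr2 in h1 h2 *; lra.
    rewrite (_ : 2 * (s + y) - 2 * s = y *+ 2); last by ring.
    by rewrite cos_mulr2n cos2sin2; field.
  rewrite sin2cos2 (_ : 2 - 2 * cos y - _ = (1 - cos y) ^+ 2); last by ring.
  have y16 : y <= 8 / 5 by lra.
  have yy : y * y <= (8 / 5) * (8 / 5) by apply: ler_pM => //; exact: ltW.
  have y4 : y ^+ 2 * (y * y) <= y ^+ 2 * ((8 / 5) * (8 / 5)).
    by rewrite ler_wpM2l// ltW.
  (* For [y <= 8 / 5] the quartic bound gives the factor [1 / 2 - (8 / 5) ^+ 2 / 24 > 39 / 100]. *)
  have h : y ^+ 2 * (39 / 100) <= 1 - cos y.
    by have := cos_le_quartic (ltW y0); lra.
  have : (y ^+ 2 * (39 / 100)) ^+ 2 <= (1 - cos y) ^+ 2.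
    have y39 : 0 <= y ^+ 2 * (39 / 100) by lra.
    by rewrite ler_sqr ?nnegrE// (le_trans y39).
  have : 0 <= y ^+ 4 by rewrite exprn_ge0// ltW.
  lra.
(* Here [y ^+ 2 <= 11 = 50 * (11 / 50)], so a gap of [11 / 50] suffices; this fixes the factor
   50. *)
move=> h4; have y4 : y ^+ 2 <= 11.
  have : y * y <= (16 / 5) * (16 / 5) by apply: ler_pM; lra.
  lra.
have a_ge0 : 0 <= 2 - 2 * cos y by have := cos_le1 y; lra.
suff : 11 / 50 <= 2 - 2 * cos y -
   ((X (s + y) - X s) ^+ 2 + (Y (s + y) - Y s) ^+ 2) by lra.
clear h4 y4 a_ge0 y2.
have pi2 := pi_ge2 R.
have s34 : s <= 3 * (pi / 4) by lra.
have [eX eY] := cap_arc s4 s34 (lexx _).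
have t35 : 3 * (pi / 4) <= s + y <= 5 * (pi / 4) + 1000^-1 by lra.
have [/andP[fX gX] /andP[fY gY]] := after_cap t35.
have cos34 : cos (2 * (3 * (pi / 4))) = 0 :> R.
  by rewrite (_ : 2 * _ = pi / 2 + pi); [rewrite cosDpi cos_pihalf oppr0|field].
have sin34 : sin (2 * (3 * (pi / 4))) = -1 :> R.
  by rewrite (_ : 2 * _ = pi / 2 + pi); [rewrite sinDpi sin_pihalf|field].
pose k := 2 * (s - pi / 4).
have sE : 2 * s = k + pi / 2 by rewrite /k; field.
have k0 : 0 <= k by rewrite /k; lra.
have k1 : k <= 1 by rewrite /k; lra.
have sin2k : 0 <= sin k <= k.
  rewrite sin_le_id// andbT; apply: sin_ge0_pi; rewrite k0 (le_trans k1)//.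
  by rewrite (le_trans _ pi2)// ler1n.
have cos2k : 0 <= cos k <= 1.
  rewrite cos_le1 andbT; apply: cos_ge0_pihalf; lra.
pose z := y - pi / 2.
have -> : cos y = - sin z by rewrite /z sinBpihalf opprK.
(* For [z >= 0] the cubic bound is used with [z <= 8 / 5], and [4 / 15 = (1 / 6) * (8 / 5)]. *)
have sin_ge : z - z ^+ 2 * (4 / 15) - 1000^-1 <= sin z.
  have z_le : z <= 8 / 5 by rewrite /z; lra.
  have z_ge : - 1000^-1 <= z by rewrite /z; lra.
  have [z0|z0] := leP 0 z.
    have : z ^+ 2 * z <= z ^+ 2 * (8 / 5) by rewrite ler_wpM2l ?sqr_ge0.
    by have := sin_ge_cubic z0; lra.
  have := @sin_le_id _ (- z); rewrite sinN oppr_ge0 => /(_ (ltW z0)).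
  by have := sqr_ge0 z; lra.
rewrite sE cosDpihalf cos34 subr0 in eX; rewrite sE sinDpihalf sin34 opprK in eY.
apply: (@near_cap_coordinates R pi s y _ (sin k) (cos k) _ _ _ _
  (X (s + y) - X (3 * (pi / 4))) (Y (s + y) - Y (3 * (pi / 4))) _ _ _ _ _ _ _ _ eX _ _ eY) => //.
- by rewrite pi2.
- by rewrite s4.
- by rewrite [RHS]addrC subrKA.
- by rewrite fX.
- by rewrite [RHS]addrC subrKA.
- by rewrite fY.
Qed.

End stadium.

(** * Planar curves as embedded curves in n-space *)

Section planar_curves.
Set Implicit Arguments.
Unset Strict Implicit.
Context (R : realType) (n : nat).
Local Notation T := (@pi R *+ 2).
Hypothesis n2 : (2 <= n)%N.
Implicit Types (a b : R) (X Y theta : R -> R).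

Definition planar_vector a b : 'rV[R]_n :=
  \row_(i < n) (if val i == 0%N then a else if val i == 1%N then b else 0).

Definition planar_curve X Y (t : R) : 'rV[R]_n := planar_vector (X t) (Y t).

Lemma planar_vectorB a b a' b' :
  planar_vector a b - planar_vector a' b' = planar_vector (a - a') (b - b').
Proof.
apply/rowP => i; rewrite !mxE; case: ifP => // _.
by case: ifP => // _; rewrite subrr.
Qed.

Lemma sqr_enorm_planar a b : enorm (planar_vector a b) ^+ 2 = a ^+ 2 + b ^+ 2.
Proof.
rewrite sqr_enorm /dotmul /planar_vector; move: n n2 => [|[|m]]// _.
rewrite !big_ord_recl big1 => [|i _]; last by rewrite !mxE/= mulr0.
by rewrite !mxE/= addr0.
Qed.

Lemma planar_curve_chord X Y s t :
  enorm (planar_curve X Y s - planar_curve X Y t) ^+ 2 = planar_chord X Y s t.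
Proof. by rewrite planar_vectorB sqr_enorm_planar. Qed.

Lemma planar_vector_inj a b a' b' : planar_vector a b = planar_vector a' b' ->
  a = a' /\ b = b'.
Proof.
move=> /eqP; rewrite -subr_eq0 planar_vectorB => /eqP e0.
have := sqr_enorm_planar (a - a') (b - b'); rewrite e0 enorm0 expr0n => /esym/eqP.
rewrite paddr_eq0 ?sqr_ge0// !sqrf_eq0 !subr_eq0.
by move=> /andP[/eqP -> /eqP ->].
Qed.

Lemma cos_lipschitz a b : `|cos a - cos b| <= `|a - b|.
Proof.
wlog ab : a b / a <= b => [hw|].
  by have [/hw//|/ltW/hw] := leP a b; rewrite distrC (distrC b).
have dN (u : R) : is_derive u 1 (fun u => - u) (-1) by exact: is_deriveN (is_derive_id u 1).
have h1 := le_of_derive ab (@is_derive_cos R) (fun u => is_derive_id u 1).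
have h2 := le_of_derive ab dN (@is_derive_cos R).
rewrite distrC (distrC a) (ger0_norm (_ : 0 <= b - a)) ?subr_ge0// ler_norml.
apply/andP; split; last by apply: h1 => u _; rewrite lerNl sin_geN1.
by rewrite opprB -opprB [X in X <= _]opprB; apply: le_trans (h2 _);
  [rewrite opprK addrC|move=> u _; rewrite lerN2 sin_le1].
Qed.

Lemma sin_lipschitz a b : `|sin a - sin b| <= `|a - b|.
Proof.
have := cos_lipschitz (a - pi / 2) (b - pi / 2).
by rewrite !cosBpihalf (_ : a - pi / 2 - _ = a - b)//; ring.
Qed.

(** Stated for a general tangent angle to serve both the unit circle and the stadium; the Lipschitz
    factor 2 is the curvature of the half circles. *)
Lemma planar_curve_embedded X Y theta :
  (forall t : R, is_derive t 1 X (cos (theta t))) ->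
  (forall t : R, is_derive t 1 Y (sin (theta t))) ->
  (forall s t, `|theta s - theta t| <= 2 * `|s - t|) ->
  (forall t, X (t + T) = X t /\ Y (t + T) = Y t) ->
  (forall s t, X s = X t -> Y s = Y t -> exists k : int, s - t = T *~ k) ->
  embedded_C11 (planar_curve X Y).
Proof.
move=> dX dY theta_lip per inj.
have dc (t : R) : derivable (planar_curve X Y) t 1.
  apply/derivable_mxP => i j.
  rewrite (_ : (fun x => planar_curve X Y x i j) =
    fun t => if val j == 0%N then X t else if val j == 1%N then Y t else 0); last first.
    by apply/funext => x; rewrite mxE.
  case: (val j == 0%N); first by case: (dX t).
  by case: (val j == 1%N); [by case: (dY t)|exact: derivable_cst].
have c'E t : derive1 (planar_curve X Y) t = planar_vector (cos (theta t)) (sin (theta t)).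
  rewrite derive1E (derive_mx (dc t)); apply/rowP => j; rewrite !mxE.
  rewrite (_ : (fun x => planar_curve X Y x ord0 j) =
    fun t => if val j == 0%N then X t else if val j == 1%N then Y t else 0); last first.
    by apply/funext => x; rewrite mxE.
  case: (val j == 0%N); first by case: (dX t).
  by case: (val j == 1%N); [by case: (dY t)|rewrite derive_cst].
split.
- by move=> t; rewrite /planar_curve (per t).1 (per t).2.
- by move=> s t /planar_vector_inj[eX eY]; exact: inj.
- move=> t; split; first exact: dc.
  apply/eqP; rewrite -(@eqrXn2 _ 2) ?enorm_ge0 ?ler01// c'E sqr_enorm_planar.
  by rewrite cos2Dsin2 expr1n.
- exists 2; split; first by rewrite num_real.
  move=> M M2 [s t] _ /=; rewrite !c'E planar_vectorB.
  apply: (@le_trans _ _ (2 * `|s - t|)); last by rewrite ler_wpM2r// ltW.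
  rewrite [X in X <= _]/Num.norm/= mx_normrE; apply: bigmax_le => [|[i j] _] /=.
    by rewrite mulr_ge0.
  rewrite mxE; case: ifP => _; last case: ifP => _.
  + exact: le_trans (cos_lipschitz _ _) (theta_lip _ _).
  + exact: le_trans (sin_lipschitz _ _) (theta_lip _ _).
  + by rewrite normr0 mulr_ge0.
Qed.

Lemma unit_circle_embedded : embedded_C11 (unit_circle (R := R) n).
Proof.
apply: (@planar_curve_embedded cos sin (fun t => t + pi / 2)).
- by move=> t; rewrite cosDpihalf; exact: is_derive_cos.
- by move=> t; rewrite sinDpihalf; exact: is_derive_sin.
- by move=> s t; rewrite opprD addrACA subrr addr0 ler_peMl// ler1n.
- by move=> t; rewrite cosD2pi sinD2pi.
move=> s t ec es.
have [k /andP[k0 kT]] := period_representative (s - t).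
exists (- k); rewrite mulrNz; apply/eqP; rewrite -subr_eq0 opprK.
set r := s - t + _ in k0 kT *.
have cosr : cos r = 1.
  rewrite (periodicMz k (@cosD2pi R)) cosB ec es -!expr2; exact: cos2Dsin2.
rewrite eq_le k0 andbT leNgt; apply/negP => r0.
have sr : 0 < sin (r / 2) by apply: sin_gt0_pi; lra.
have := chordE r; rewrite cosr mulr1 subrr => /esym/eqP.
by rewrite gt_eqF// mulr_gt0// exprn_gt0.
Qed.

End planar_curves.

(** * Restricting the energy density to a fixed base point *)

Section sections_of_energy_density.
Set Implicit Arguments.
Unset Strict Implicit.
Context (R : realType) (n : nat) (F : R -> R -> R) (c : R -> 'rV[R]_n).
Local Notation mu := (@lebesgue_measure R).
Local Notation T := (@pi R *+ 2).

(** The density along the slice is replaced by a measurable representative [G], because [F] carries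
    no measurability. *)
Definition integrable_section (s : R) := exists G : R -> R,
  [/\ measurable_fun setT G, mu.-integrable `]0, pi[ (EFin \o G) &
   {ae mu, forall y, 0 < y < pi -> F (enorm (c s - c (s + y))) y = G y}].

Lemma ae_null_xsection (N : set (R * R)) : measurable N -> (leb2 R) N = 0%E ->
  {ae mu, forall s, mu (xsection N s) = 0%E}.
Proof.
move=> mN N0.
have mf : measurable_fun setT (fun s => mu (xsection N s)).
  exact: (@measurable_fun_xsection _ _ _ _ _ mu).
have : (\int[mu]_s `|mu (xsection N s)| = 0)%E.
  rewrite -[RHS]N0; apply: eq_integral => s _ /=; rewrite gee0_abs//.
move/(ae_eq_integral_abs mu measurableT mf).1.
by apply: ae_imply => s /= /(_ I).
Qed.

Lemma shift_null (s : R) (N : set R) : measurable N -> mu N = 0%E ->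
  {ae mu, forall y, ~ N (s + y)}.
Proof.
move=> mN N0; exists ((fun y => y + s) @^-1` N); split.
- by rewrite -[X in measurable X]setTI; exact: measurable_shift.
- by rewrite -[RHS]N0 -(lebesgue_measure_shift s mN).
- by move=> y /= /contrapT; rewrite addrC.
Qed.

(** Fubini's theorem is applied to the Borel representative and to the null set where it differs
    from the density. For [0 <= s <= pi] and [0 < y < pi] the point [(s, s + y)] stays in the
    fundamental domain. *)
Lemma ae_integrable_section : lebesgue_integrable (@torus R) (energy_density F c) ->
  {ae mu, forall s, 0 <= s <= pi -> integrable_section s}.
Proof.
move=> [g ig [N [mN N0 gN]]].
have ig' : (leb2 R).-integrable setT (g \_ (@torus R)).
  by rewrite -integrable_mkcond //; exact: measurable_torus.
have := ae_integrable1 ig'.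
apply: (ae_imply2 _ (ae_null_xsection mN N0)) => s Ns is_ /andP[s0 spi].
pose h y := (g \_ (@torus R)) (s, s + y).
have pi0 := pi_gt0 R.
have mg := measurable_int _ is_.
have mh : measurable_fun setT h.
  by apply: measurableT_comp mg _; exact: measurable_funD.
have ih : mu.-integrable `]0, pi[ h.
  apply/integrableP; split; first exact: measurable_funTS.
  have /integrableP[_ is_fin] := is_.
  have sh := @ge0_integral_shift _ s setT (fun y => `|(g \_ (@torus R)) (s, y)|%E) measurableT.
  rewrite preimage_setT in sh.
  apply: (@le_lt_trans _ _ (\int[mu]_y `|h y|)%E).
    by apply: ge0_subset_integral => //; exact: measurableT_comp.
  under eq_integral do rewrite /h addrC.
  by rewrite sh//; exact: measurableT_comp.
exists (fine \o h); split.
- exact: measurableT_comp.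
- apply: le_integrable ih; first exact: measurable_itv.
    by apply: measurable_funTS; apply/measurable_EFinP; exact: measurableT_comp.
  by move=> y _ /=; case: (h y) => //=; rewrite normr0 leey.
have mNs : measurable (xsection N s) by exact: measurable_xsection.
apply: ae_imply (shift_null s mNs Ns) => y nN /andP[y0 ypi].
have torus_sy : @torus R (s, s + y).
  by split; rewrite /= in_itv/=; apply/andP; split; lra.
have : energy_density F c (s, s + y) = g (s, s + y).
  apply: contrapT => ne; apply: nN; apply/xsectionP; apply: gN => /= h'.
  by apply: ne; exact: h'.
rewrite /energy_density/= circle_dist_shift addrAC subrr add0r circle_dist0_small.
  by rewrite /h patchE mem_set// => <-.
by rewrite !ltW.
Qed.

End sections_of_energy_density.

(** * Supporting slopes of convex functions from countably many values *)

Section convex_slopes.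
Set Implicit Arguments.
Unset Strict Implicit.
Context (R : realType).

Lemma convex_three_points (D : set R^o) (f : R -> R) (a b c : R) :
  convex_function (D : set R^o) f -> a < b -> b < c -> D a -> D c ->
  (c - a) * f b <= (c - b) * f a + (b - a) * f c.
Proof.
move=> cf ab bc Da Dc.
have ca : 0 < c - a by lra.
pose t := (c - b) / (c - a).
have t0 : 0 <= t by rewrite divr_ge0//; lra.
have t1 : t <= 1 by rewrite ler_pdivrMr//; lra.
have := cf (Itv01 t0 t1) a c (mem_set Da) (mem_set Dc).
move=> h.
have {}h : f (t * a + (1 - t) * c) <= t * f a + (1 - t) * f c by exact: h.
have tb : t * a + (1 - t) * c = b by rewrite /t; field; lra.
rewrite tb -(ler_pM2l ca) in h; apply: le_trans h _.
by rewrite le_eqVlt; apply/orP; left; apply/eqP; rewrite /t; field; lra.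
Qed.

(** The sign is opposite to that of the slope, so it is positive for decreasing functions. The value
    [+oo] removes the points that are not to the left of [a] from an infimum. *)
Definition chord_slope (f0 f1 a x : R) : \bar R :=
  if x < a then ((f1 - f0) / (a - x))%:E else +oo%E.

(* The supporting line is obtained from countably many values of f, so that its slope is
   a measurable function of these values. *)
Lemma supporting_slope (f : R -> R) (b a : R) (x : nat -> R) :
  convex_function (`]0, b]%classic : set R^o) f ->
  {in `]0, b] &, forall u v : R, u < v -> f v < f u} ->
  0 < a < b -> (forall k, 0 < x k) ->
  (forall u, 0 < u < a -> exists k, u < x k < a) ->
  exists w, [/\ ereal_inf (range (fun k => chord_slope (f a) (f (x k)) a (x k))) = w%:E,
    0 < w & forall u, 0 < u <= b -> f a + w * (a - u) <= f u].
Proof.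
move=> cf df /andP[a0 ab] x0 dense.
set S := (X in ereal_inf X).
have inD u : 0 < u <= b -> `]0, b]%classic u by rewrite /= in_itv.
have conv u v z : 0 < u -> u < v -> v < z -> z <= b ->
    (z - u) * f v <= (z - v) * f u + (v - u) * f z.
  move=> u0 uv vz zb; apply: (convex_three_points cf) => //; apply: inD; lra.
(* By convexity each chord to the right of [a] bounds all chords to its left, hence their
   infimum. *)
have lower z : a < z <= b -> lbound S ((f a - f z) / (z - a))%:E.
  move=> /andP[az zb] _ [k _ <-]; rewrite /chord_slope; case: ifP => [xa|_]; last exact: leey.
  rewrite lee_fin ler_pdivlMr ?subr_gt0// mulrAC ler_pdivrMr ?subr_gt0//.
  have := conv _ _ _ (x0 k) xa az zb; lra.
(* An arbitrary [u < a] is compared with some [x k] between [u] and [a], whose negated slope is no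
   larger. *)
have upper u : 0 < u < a -> (ereal_inf S <= ((f u - f a) / (a - u))%:E)%E.
  move=> /andP[u0 ua]; have [k /andP[ux xa]] := dense u (introT andP (conj u0 ua)).
  apply: (@le_trans _ _ (chord_slope (f a) (f (x k)) a (x k))).
    by apply: ereal_inf_lbound; exists k.
  rewrite /chord_slope xa lee_fin ler_pdivrMr ?subr_gt0// mulrAC ler_pdivlMr ?subr_gt0//.
  have := conv _ _ _ u0 ux xa (ltW ab); lra.
have bb : a < b <= b by rewrite ab lexx.
(* Strict decrease between [a] and [b] is what makes the slope nonzero. *)
have L0 : 0 < (f a - f b) / (b - a).
  rewrite divr_gt0 ?subr_gt0// df// in_itv/=; lra.
have infL : (((f a - f b) / (b - a))%:E <= ereal_inf S)%E by apply: le_ereal_inf_tmp; exact: lower.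
have inf_fin : ereal_inf S \is a fin_num.
  have a2 : 0 < a / 2 < a by lra.
  rewrite fin_real//; apply/andP; split.
    by apply: lt_le_trans infL; exact: ltNyr.
  by apply: le_lt_trans (upper _ a2) _; exact: ltry.
exists (fine (ereal_inf S)); rewrite fineK//; split => //.
  by rewrite -lte_fin fineK//; apply: lt_le_trans infL; rewrite lte_fin.
move=> u /andP[u0 ub]; have [ua|au|->] := ltgtP u a; last by rewrite subrr mulr0 addr0.
  have := upper u (introT andP (conj u0 ua)).
  rewrite -(fineK inf_fin) lee_fin ler_pdivlMr ?subr_gt0//; lra.
have : (((f a - f u) / (u - a))%:E <= ereal_inf S)%E.
  by apply: le_ereal_inf_tmp; apply: lower; rewrite au.
rewrite -(fineK inf_fin) lee_fin ler_pdivrMr ?subr_gt0//; lra.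
Qed.

(** One point of the full-measure set is chosen in each rational subinterval of [[a, b]]; the other
    indices receive a default point. *)
Lemma dense_sequence (P : R -> Prop) (a b : R) : a < b ->
  {ae @lebesgue_measure R, forall x, a <= x <= b -> P x} ->
  exists s : nat -> R, (forall k, a <= s k <= b /\ P (s k)) /\
    (forall u v, u < v -> a <= u -> v <= b -> exists k, u < s k < v).
Proof.
move=> ab aeP.
have pick u v : u < v -> a <= u -> v <= b -> exists x, [/\ a <= x <= b, P x & u < x < v].
  move=> uv au vb; have [x /andP[ux xv] Px] := ae_exists_itv uv aeP.
  have axb : a <= x <= b by rewrite (le_trans au (ltW ux)) (le_trans (ltW xv) vb).
  by exists x; split; [|exact: Px|rewrite ux xv].
have ex k : exists x, (a <= x <= b /\ P x) /\ forall q : rat * rat, unpickle k = Some q ->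
    ratr q.1 < ratr q.2 :> R -> a <= ratr q.1 -> ratr q.2 <= b -> ratr q.1 < x < ratr q.2.
  have [x0 [ax0 Px0 _]] := pick a b ab (lexx _) (lexx _).
  case: (unpickle k) => [q|]; last by exists x0.
  have [[q12 [aq qb]]|nq] := pselect (ratr q.1 < ratr q.2 :> R /\ a <= ratr q.1 /\ ratr q.2 <= b).
    have [x [axb Px qx]] := pick _ _ q12 aq qb.
    by exists x; split => // _ [<-].
  by exists x0; split => // q' [<-] h1 h2 h3; exfalso; apply: nq.
have [s hs] := choice ex.
exists s; split => [k|u v uv au vb]; first by case: (hs k).
have [m1] := rat_in_itvoo uv; rewrite in_itv/= => /andP[um mv].
have [m2] := rat_in_itvoo mv; rewrite in_itv/= => /andP[m12 m2v].
exists (pickle (m1, m2)); have [_ h] := hs (pickle (m1, m2)).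
have /andP[h1 h2] := h _ (pickleK _) m12 (le_trans au (ltW um)) (le_trans (ltW m2v) vb).
by rewrite (lt_trans um h1) (lt_trans h2 m2v).
Qed.

End convex_slopes.

(** * Measurable supporting lines from the unit circle and the stadium *)

Section existence_of_supporting_lines.
Set Implicit Arguments.
Unset Strict Implicit.
Context (R : realType).
Local Notation mu := (@lebesgue_measure R).

Lemma chord_lt_sqr (y : R) : 0 < y < pi -> 0 < 2 - 2 * cos y < y ^+ 2.
Proof.
move=> /andP[y0 ypi]; rewrite chord_gt0 ?y0 ?(ltW ypi)//= chordE.
have h0 : 0 < y / 2 by rewrite divr_gt0.
have sin_lt : sin (y / 2) < y / 2.
  suff : sin (y / 2) - sin 0 < y / 2 - 0 by rewrite sin0 !subr0.
  apply: (@lt_of_derive _ sin id cos (fun=> 1)) => // x /andP[x0 xy].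
  by rewrite -cos0; apply: cos_lt_cos => //; lra.
have s0 : 0 < sin (y / 2) by apply: sin_gt0_pi; apply/andP; split; lra.
have -> : y ^+ 2 = 4 * (y / 2) ^+ 2 by field.
by rewrite ltr_pM2l// ltr_pXn2r ?nnegrE// ltW.
Qed.

Lemma continuous_of_derive (f df : R -> R) :
  (forall t : R, is_derive t 1 f (df t)) -> continuous f.
Proof.
by move=> hf t; apply/differentiable_continuous/derivable1_diffP; case: (hf t).
Qed.

Lemma measurable_chord_slope (f0 f1 a x : R -> R) :
  measurable_fun setT f0 -> measurable_fun setT f1 ->
  measurable_fun setT a -> measurable_fun setT x ->
  measurable_fun setT (fun y => chord_slope (f0 y) (f1 y) (a y) (x y)).
Proof.
move=> mf0 mf1 ma mx.
(* The denominator is positive where it is used, so the quotient is a product with a real power,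
   which is measurable. *)
have -> : (fun y => chord_slope (f0 y) (f1 y) (a y) (x y)) =
    (fun y => if x y < a y then ((f1 y - f0 y) * ((a y - x y) `^ (-1)))%:E else +oo%E).
  apply/funext => y; rewrite /chord_slope; case: ifP => // xa.
  by rewrite powR_inv1// subr_ge0 ltW.
apply: measurable_fun_ifT => //; first exact: measurable_fun_ltr.
apply/measurable_EFinP; apply: measurable_funM; first exact: measurable_funB.
by apply: (measurableT_comp (measurable_powR _)); exact: measurable_funB.
Qed.

Variables (n : nat) (F : R -> R -> R).
Hypothesis hn : (2 <= n)%N.
Hypothesis hconvex : forall y : R, 0 < y < pi ->
  convex_function (`]0, y ^+ 2]%classic : set R^o) (fun x : R => F (Num.sqrt x) y).
Hypothesis hdecr : forall y : R, 0 < y < pi ->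
  {in `]0, y ^+ 2] &, forall a b : R, a < b -> F (Num.sqrt b) y < F (Num.sqrt a) y}.
Hypothesis hF : renormalization_energy n F.

Let a0 (y : R) : R := 2 - 2 * cos y.

Let ma0 : measurable_fun setT a0.
Proof.
apply: measurable_funB => //; apply: measurable_funM => //.
exact: continuous_measurable_fun (@continuous_cos R).
Qed.

(** Chords of the unit circle depend on the offset only, so one good base point determines [p]. *)
Lemma unit_circle_section : exists p : R -> R,
  [/\ measurable_fun setT p, mu.-integrable `]0, pi[ (EFin \o p) &
   {ae mu, forall y, 0 < y < pi -> F (Num.sqrt (a0 y)) y = p y}].
Proof.
have := ae_integrable_section (hF (unit_circle_embedded R hn)).
move=> /(ae_exists_itv (pi_gt0 R)) [s /andP[s0 spi]].
have s0pi : 0 <= s <= pi by rewrite !ltW.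
move=> /(_ s0pi) [p [mp ip pE]]; exists p; split => //.
apply: ae_imply pE => y hy y0pi; rewrite -hy//; congr F.
have := round_circle1_chord s (s + y) (unit_circle_round R hn).
rewrite opprD addrA subrr sub0r cosN => /(congr1 Num.sqrt).
by rewrite sqrtr_sqr ger0_norm ?enorm_ge0.
Qed.

Lemma stadium_sections : exists (X Y : R -> R) (s : nat -> R) (G : nat -> R -> R),
  [/\ forall t : R, is_derive t 1 X (cos (stadium_angle t)),
      forall t : R, is_derive t 1 Y (sin (stadium_angle t)),
      forall u v, u < v -> 0 <= u -> v <= pi -> exists k, u < s k < v &
      forall k, [/\ measurable_fun setT (G k), mu.-integrable `]0, pi[ (EFin \o G k) &
        {ae mu, forall y, 0 < y < pi ->
           F (Num.sqrt (planar_chord X Y (s k) (s k + y))) y = G k y}]].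
Proof.
have cth := @stadium_angle_continuous R.
have [X dX] : exists X : R -> R, forall t : R, is_derive t 1 X (cos (stadium_angle t)).
  apply: (@antiderivative_exists _ (fun t => cos (stadium_angle t))) => t.
  exact: (continuous_comp (cth t) (@continuous_cos R _)).
have [Y dY] : exists Y : R -> R, forall t : R, is_derive t 1 Y (sin (stadium_angle t)).
  apply: (@antiderivative_exists _ (fun t => sin (stadium_angle t))) => t.
  exact: (continuous_comp (cth t) (@continuous_sin R _)).
have emb := planar_curve_embedded hn dX dY (@stadium_angle_lipschitz R)
  (stadium_periodic dX dY) (stadium_injective dX dY).
have [s [s_good s_dense]] := dense_sequence (pi_gt0 R) (ae_integrable_section (hF emb)).
have [G hG] := choice (fun k => (s_good k).2).
exists X, Y, s, G; split => // k.
have [mG iG GE] := hG k; split => //; apply: ae_imply GE => y hy y0pi.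
rewrite -hy//; congr F.
by rewrite -(planar_curve_chord hn) sqrtr_sqr ger0_norm ?enorm_ge0.
Qed.

Lemma planar_chord_gt0 (X Y : R -> R) (s y : R) :
  (forall t : R, is_derive t 1 X (cos (stadium_angle t))) ->
  (forall t : R, is_derive t 1 Y (sin (stadium_angle t))) ->
  0 < y < pi -> 0 < planar_chord X Y s (s + y).
Proof.
move=> dX dY /andP[y0 ypi].
rewrite lt_def addr_ge0 ?sqr_ge0// andbT paddr_eq0 ?sqr_ge0// !sqrf_eq0 !subr_eq0.
apply/negP => /andP[/eqP eX /eqP eY].
have [k] := stadium_injective dX dY eX eY.
rewrite opprD addrA subrr sub0r => yk.
have pi0 := pi_gt0 R; have T0 : 0 <= pi *+ 2 :> R by rewrite mulrn_wge0// ltW.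
case: k yk => m yk.
  have : 0 <= (pi *+ 2) *+ m :> R by exact: mulrn_wge0.
  by rewrite pmulrn -yk; lra.
have {}yk : y = (pi *+ 2) *+ m.+1 by apply: oppr_inj; exact: yk.
have : 0 <= (pi *+ 2) *+ m :> R by exact: mulrn_wge0.
by rewrite mulrS in yk; lra.
Qed.

(** As the base point moves from around a half circle to around a side, the squared chord of offset
    [y] passes continuously from below [a0 y] to above it. It thus takes a value between [u] and
    [a0 y], and remains in this range on an open set of base points, which contains some [s k]. *)
Lemma planar_chord_dense (X Y : R -> R) (s : nat -> R) (y u : R) :
  (forall t : R, is_derive t 1 X (cos (stadium_angle t))) ->
  (forall t : R, is_derive t 1 Y (sin (stadium_angle t))) ->
  (forall u v, u < v -> 0 <= u -> v <= pi -> exists k, u < s k < v) ->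
  0 < y < pi -> u < a0 y ->
  exists k, u < planar_chord X Y (s k) (s k + y) < a0 y.
Proof.
move=> dX dY dense y0pi ua; have /andP[y0 ypi] := y0pi.
pose h t := planar_chord X Y t (t + y).
have cX := continuous_of_derive dX.
have cY := continuous_of_derive dY.
have cS : continuous (fun t : R => t + y) by move=> t; apply: cvgD; [exact: cvg_id|exact: cvg_cst].
have ch : continuous h.
  move=> t; apply: cvgD; apply: cvgM; apply: cvgB; try exact: cX; try exact: cY.
  - exact: (continuous_comp (cS t) (cX _)).
  - exact: (continuous_comp (cS t) (cX _)).
  - exact: (continuous_comp (cS t) (cY _)).
  - exact: (continuous_comp (cS t) (cY _)).
have h_cap : h (pi / 2 - y / 2) < a0 y.
  have := planar_chord_cap dX dY y0pi; rewrite /h (_ : _ - _ + y = pi / 2 + y / 2)//; lra.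
have h_side : a0 y < h (pi - y / 2).
  have := planar_chord_side Y dX y0pi; rewrite /h (_ : _ - _ + y = pi + y / 2)//; lra.
pose lo := Num.max u (h (pi / 2 - y / 2)).
have [ulo hlo] : u <= lo /\ h (pi / 2 - y / 2) <= lo by rewrite !le_max !lexx orbT.
have loa : lo < a0 y by rewrite gt_max ua.
have ab : pi / 2 - y / 2 <= pi - y / 2 by lra.
have cw : {within `[pi / 2 - y / 2, pi - y / 2], continuous h} by exact: continuous_subspaceT.
have vb : Num.min (h (pi / 2 - y / 2)) (h (pi - y / 2)) <= (lo + a0 y) / 2
    <= Num.max (h (pi / 2 - y / 2)) (h (pi - y / 2)).
  by rewrite ge_min le_max; apply/andP; split; apply/orP; [left|right]; lra.
have [t] := IVT ab cw vb; rewrite in_itv/= => /andP[t1 t2] ht.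
have e0 : 0 < (a0 y - lo) / 2 by lra.
have /nbhs_ballP[d /= d0 hd] : \forall z \near t, `|h t - h z| < (a0 y - lo) / 2.
  by have /cvgrPdist_lt := ch t; exact.
have m0 : Num.max 0 (t - d) < t by rewrite gt_max; apply/andP; split; lra.
have [||k /andP[]] := dense _ _ m0; first by rewrite le_max lexx.
  lra.
rewrite gt_max => /andP[sk0 sk1] sk2; exists k.
have /hd : ball t d (s k) by rewrite /ball/= ltr_distl; apply/andP; split; lra.
by rewrite /= ht ltr_distl -/(h (s k)) => /andP[]; lra.
Qed.

Lemma supporting_lines_exist : exists p w, supporting_lines F p w.
Proof.
have [p [mp ip pE]] := unit_circle_section.
have [X [Y [s [G [dX dY dense hG]]]]] := stadium_sections.
have pi0 := pi_gt0 R.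
pose x k y := planar_chord X Y (s k) (s k + y).
pose slope k y := chord_slope (p y) (G k y) (a0 y) (x k y).
(* For almost every [y] in []0, pi[] the infimum is a positive real. Elsewhere [fine] and
   [Num.max 0] supply values that keep [w] measurable and nonnegative. *)
pose w y := Num.max 0 (fine (einfs (slope ^~ y) 0)).
have cX := continuous_of_derive dX.
have cY := continuous_of_derive dY.
have mx k : measurable_fun setT (x k).
  have mD : measurable_fun setT (fun y => s k + y) by exact: measurable_funD.
  by apply: measurable_funD; apply: measurable_funX; apply: measurable_funB => //;
    apply: measurableT_comp mD; exact: continuous_measurable_fun.
have mw : measurable_fun setT w.
  apply: measurable_maxr => //; apply: measurableT_comp => //.
  by apply: measurable_fun_einfs => k; apply: measurable_chord_slope => //; case: (hG k).
have w_ge0 y : 0 <= w y by rewrite le_max lexx.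
have einfsE y : einfs (slope ^~ y) 0 = ereal_inf (range (slope ^~ y)).
  by rewrite /einfs /sdrop; congr ereal_inf; apply/seteqP; split => _ [k _ <-]; exists k.
have aeG : {ae mu, forall y, forall k, 0 < y < pi -> F (Num.sqrt (x k y)) y = G k y}.
  by apply: ae_foralln => k; case: (hG k).
have lines : {ae mu, forall y, 0 < y < pi ->
    [/\ F (Num.sqrt (a0 y)) y = p y, 0 < w y,
      forall k, x k y < a0 y -> w y <= (G k y - p y) / (a0 y - x k y) &
      forall z, 0 < z <= y ^+ 2 -> p y + w y * (a0 y - z) <= F (Num.sqrt z) y]}.
  apply: ae_imply2 pE aeG => y py Gy y0pi.
  have x0 k : 0 < x k y by exact: planar_chord_gt0 dX dY y0pi.
  have dx u : 0 < u < a0 y -> exists k, u < x k y < a0 y.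
    by move=> /andP[_ ua]; exact: planar_chord_dense dX dY dense y0pi ua.
  have [v [infE v0 line]] :=
    supporting_slope (hconvex y0pi) (hdecr y0pi) (chord_lt_sqr y0pi) x0 dx.
  have slopeE k : slope k y = chord_slope (F (Num.sqrt (a0 y)) y) (F (Num.sqrt (x k y)) y)
      (a0 y) (x k y) by rewrite py// Gy.
  have {}infE : einfs (slope ^~ y) 0 = v%:E.
    rewrite einfsE -infE; apply: (congr1 (fun f => ereal_inf (range f))).
    by apply/funext => k; exact: slopeE.
  have wE : w y = v by rewrite /w infE/= max_r// ltW.
  rewrite wE -(py y0pi); split => // k xa.
  rewrite -lee_fin -infE einfsE; apply: ereal_inf_lbound; exists k => //.
  by rewrite slopeE /chord_slope xa Gy.
exists p, w; split; split => //.
  by apply: ae_imply lines => y hy y0pi; have [h1 h2 _ h3] := hy y0pi.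
(* Near the end of a cap, planar_chord_near_cap bounds y^2 - a0(y) by a multiple of the
   denominator of the chord slope, so that one section controls w (y^2 - a0). *)
have k4 : pi / 4 < pi / 4 + 1000^-1 :> R by rewrite ltrDl invr_gt0 ltr0n.
have [||k /andP[sk1 sk2]] := dense _ _ k4; [lra|have := pi_ge2 R; lra|].
have sk : pi / 4 <= s k <= pi / 4 + 1000^-1 by rewrite !ltW.
have [mGk iGk _] := hG k.
have mI : measurable (`]0%R, pi[%classic : set (measurableTypeR R)) by exact: measurable_itv.
have mW : measurable_fun setT (fun y => w y * (y ^+ 2 - (2 - 2 * cos y))).
  by apply: measurable_funM => //; apply: measurable_funB.
have iH : mu.-integrable `]0, pi[ (EFin \o (fun y => 50 * (G k y - p y))).
  apply: (integrable_EFinZ 50 mI); exact: (eq_integrable mI _ _ _ (integrableB mI iGk ip)).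
apply/integrableP; split; first by apply: measurable_funTS; exact/measurable_EFinP.
have /integrableP[_] := iH; apply: le_lt_trans; apply: ae_le_integral_nonmeasurable.
apply: ae_imply lines => y hy; rewrite /= in_itv/= => y0pi.
have [_ w0 w_le _] := hy y0pi.
have /andP[a_gt0 a_lt] := chord_lt_sqr y0pi.
have cap := planar_chord_near_cap dX dY sk y0pi.
rewrite lee_fin; apply: le_trans (ler_norm _).
rewrite ger0_norm; last by rewrite mulr_ge0// subr_ge0 ltW.
have xa : x k y < a0 y.
  rewrite -subr_gt0 -(pmulr_rgt0 _ (ltr0n _ 50));
  by apply: lt_le_trans cap; rewrite subr_gt0.
have := w_le _ xa; rewrite ler_pdivlMr ?subr_gt0// => h.
apply: le_trans (ler_wpM2l (w_ge0 y) cap) _.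
by rewrite mulrCA ler_pM2l.
Qed.

End existence_of_supporting_lines.

Theorem theorem1p2 (R : realType) (n : nat) (F : R -> R -> R)
    (hn : (2 <= n)%N)
    (hconvex : forall y : R, 0 < y < pi ->
       convex_function (`]0, y ^+ 2]%classic : set R^o)
         (fun x : R => F (Num.sqrt x) y))
    (hdecr : forall y : R, 0 < y < pi ->
       {in `]0, y ^+ 2] &,
         forall a b : R, a < b -> F (Num.sqrt b) y < F (Num.sqrt a) y})
    (hF : renormalization_energy n F) :
  forall c : R -> 'rV[R]_n, closed_unit_speed c ->
    (energy F (unit_circle n) <= energy F c)%E /\
    (energy F c = energy F (unit_circle n) <-> round_circle1 c).
Proof.
have [p [w lines]] := supporting_lines_exist hn hconvex hdecr hF.
move=> c cc; split; first exact: (energy_unit_circle_le hn lines).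
split=> [|rc]; first exact: (energy_eq_round hn lines).
exact: (energy_round F rc (unit_circle_round R hn)).
Qed.
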